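(* Let $\mathbb{K}$ be an algebraically closed field of characteristic $0$. In the brackets below, brackets of basis vectors that are not listed are zero or deduced by skew-symmetry. (1) The $5$-dimensional Lie algebra $\mathfrak{g}_5$ with basis $X_1,\dots,X_5$ and brackets $[X_1,X_2]=X_3$, $[X_1,X_4]=X_5$ is rigid in $2Nilp_5$. (2) Let $\mathfrak{g}_7$ be the $7$-dimensional $2$-step nilpotent Lie algebra with basis $X_1,\dots,X_7$ and brackets $$[X_1,X_{2i}]=X_{2i+1}\ (1\le i\le 3),\quad [X_2,X_4]=X_7,\quad [X_2,X_6]=X_5,\quad [X_4,X_6]=X_3.$$ Then $\mathfrak{g}_7$ is rigid in $2Nilp_7$, and any Lie algebra of $\mathcal{F}^{7,2}_{3,1}$ is isomorphic to a contraction of $\mathfrak{g}_7$. (3) Let $\mathfrak{g}_9$ be the $9$-dimensional Lie algebra with basis $X_1,\dots,X_9$ and brackets $$[X_1,X_{2i}]=X_{2i+1}\ (1\le i\le 4),\quad [X_2,X_4]=X_7,\quad [X_2,X_8]=X_5,\quad [X_4,X_6]=X_9,\quad [X_6,X_8]=X_3.$$ Then $\mathfrak{g}_9$ is rigid in $2Nilp_9$, and any Lie algebra of $\mathcal{F}^{9,2}_{4,1}$ is isomorphic to a contraction of $\mathfrak{g}_9$.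
   Context: $2Nilp_n$ is the algebraic variety of all skew-symmetric bilinear maps $\mu:\mathbb{K}^n\times\mathbb{K}^n\to\mathbb{K}^n$ satisfying $\mu(\mu(X,Y),Z)=0$ for all $X,Y,Z$ (viewed in $\mathbb{K}^{n^3}$ via structure constants); a Lie algebra $(\mathbb{K}^n,\mu)$ is identified with $\mu$. The group $GL(n,\mathbb{K})$ acts by $(f\cdot\mu)(X,Y)=f^{-1}\mu(f(X),f(Y))$, and the orbit of $\mu$ is the set of Lie algebras isomorphic to it. $\mu\in 2Nilp_n$ is rigid in $2Nilp_n$ if its orbit is Zariski open in $2Nilp_n$. A contraction of $\mu$ is a Lie algebra law in the Zariski closure of the orbit of $\mu$. For a nilpotent Lie algebra $\mathfrak{g}$ and $X\in\mathfrak{g}$, $c(X)$ is the decreasing sequence of the dimensions of the Jordan blocks of the nilpotent operator $\mathrm{ad}(X)$; the characteristic sequence of $\mathfrak{g}$ is $c(\mathfrak{g})=\max\{c(X): X\in\mathfrak{g}\setminus[\mathfrak{g},\mathfrak{g}]\}$ for the lexicographic order. $\mathcal{F}^{2p+1,2}_{p,1}$ denotes the family of $(2p+1)$-dimensional $2$-step nilpotent Lie algebras over $\mathbb{K}$ with characteristic sequence $(2,\dots,2,1)$, where $2$ appears $p$ times. *)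

(* Defs.v *)
From mathcomp Require Import all_boot all_order all_algebra.
From mathcomp Require Import mpoly.

Set Implicit Arguments.
Unset Strict Implicit.
Unset Printing Implicit Defensive.

Import GRing.Theory.
Local Open Scope ring_scope.

(* A bilinear map K^n x K^n -> K^n, given by its structure constants: the row
   of index (i, j) is the image of the i-th and j-th vectors of the canonical
   basis, so C_ij^k is the entry ((i, j), k).  Elements of K^n are row
   vectors, and matrices act on them on the right. *)
Notation law K n := 'M[K]_(n * n, n).

Section Laws.

Variables (K : fieldType) (n : nat).
Implicit Types (mu nu : law K n) (x y z : 'rV[K]_n) (f A : 'M[K]_n).

Definition bracket mu x y : 'rV[K]_n := mxvec (x^T *m y) *m mu.

Definition law_of (B : 'rV[K]_n -> 'rV[K]_n -> 'rV[K]_n) : law K n :=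
  (\matrix_(k < n)
     mxvec (\matrix_(i < n, j < n) B (delta_mx 0 i) (delta_mx 0 j) 0 k))^T.

Definition skew_symmetric mu : Prop :=
  forall x y, bracket mu x y = - bracket mu y x.

Definition is_Lie mu : Prop :=
  skew_symmetric mu /\
  forall x y z, bracket mu (bracket mu x y) z
              + bracket mu (bracket mu y z) x
              + bracket mu (bracket mu z x) y = 0.

Definition two_nilp mu : Prop :=
  skew_symmetric mu /\ forall x y z, bracket mu (bracket mu x y) z = 0.

Definition act f mu : law K n :=
  law_of (fun x y => bracket mu (x *m f) (y *m f) *m invmx f).

Definition law_orbit mu : law K n -> Prop :=
  fun nu => exists2 f, f \in unitmx & nu = act f mu.

(* Zariski topology on K^(n^3), the coordinates of mu being the entries of
   mxvec mu. *)
Definition Zariski_closed (C : law K n -> Prop) : Prop :=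
  exists S : {mpoly K[n * n * n]} -> Prop,
    forall mu, C mu <-> forall p, S p -> p.@[mxvec mu 0] = 0.

Definition Zariski_open (U : law K n -> Prop) : Prop :=
  Zariski_closed (fun mu => ~ U mu).

Definition Zariski_open_in (V U : law K n -> Prop) : Prop :=
  exists2 W, Zariski_open W & forall mu, U mu <-> W mu /\ V mu.

Definition Zariski_closure (U : law K n -> Prop) : law K n -> Prop :=
  fun mu => forall C, Zariski_closed C -> (forall nu, U nu -> C nu) -> C mu.

Definition rigid mu : Prop :=
  two_nilp mu /\ Zariski_open_in two_nilp (law_orbit mu).

Definition contraction mu nu : Prop :=
  is_Lie nu /\ Zariski_closure (law_orbit mu) nu.

(* The subspace [g, g], as the span of all brackets: it is the intersection of
   the subspaces (row spaces of matrices W) containing every bracket. *)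
Definition in_derived mu x : Prop :=
  forall W : 'M[K]_n, (forall y z, (bracket mu y z <= W)%MS) -> (x <= W)%MS.

Definition ad mu x : 'M[K]_n := lin1_mx (bracket mu x).

Definition Jordan_block (m : nat) : 'M[K]_m :=
  \matrix_(i < m, j < m) (i.+1 == j :> nat)%:R.

(* s is the decreasing sequence of the sizes of the Jordan blocks of the
   nilpotent operator A.  The rows of P form a Jordan basis; P is rectangular
   only because n and \sum_i s`_i are not convertible. *)
Definition Jordan_type A (s : seq nat) : Prop :=
  [/\ sorted geq s, all (leq 1) s
    & exists2 P : 'M[K]_(\sum_(i < size s) nth 0%N s i, n),
        row_free P && row_full P
        & P *m A = (\mxdiag_(i < size s) Jordan_block (nth 0%N s i)) *m P].

Definition char_sequence mu (s : seq nat) : Prop :=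
  (exists2 x, ~ in_derived mu x & Jordan_type (ad mu x) s) /\
  (forall y t, ~ in_derived mu y -> Jordan_type (ad mu y) t ->
     ((t : seqlexi nat) <= s)%O).

End Laws.

(* F^{2p+1,2}_{p,1}: 2-step nilpotent laws on K^(2p+1) with characteristic
   sequence (2, ..., 2, 1), which excludes the abelian law when p > 0. *)
Definition familyF (K : fieldType) (p : nat) (mu : law K (2 * p + 1)) : Prop :=
  two_nilp mu /\ char_sequence mu (rcons (nseq p 2%N) 1%N).

(* The skew-symmetric law whose nonzero brackets of basis vectors X_1, ..., X_n
   are, up to skew-symmetry, [X_i, X_j] = X_k for (i, j, k) in b; the indices
   in b start at 1. *)
Definition basis_law (K : fieldType) (n : nat) (b : seq (nat * nat * nat)) :
    law K n :=
  (\matrix_(k < n) mxvec (\matrix_(i < n, j < n)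
     (((i.+1, j.+1, k.+1) \in b)%:R - ((j.+1, i.+1, k.+1) \in b)%:R)))^T.

Definition g5 (K : fieldType) : law K 5 :=
  basis_law K 5 [:: (1, 2, 3); (1, 4, 5)]%N.

Definition g7 (K : fieldType) : law K 7 :=
  basis_law K 7 [:: (1, 2, 3); (1, 4, 5); (1, 6, 7);
                    (2, 4, 7); (2, 6, 5); (4, 6, 3)]%N.

Definition g9 (K : fieldType) : law K 9 :=
  basis_law K 9 [:: (1, 2, 3); (1, 4, 5); (1, 6, 7); (1, 8, 9);
                    (2, 4, 7); (2, 8, 5); (4, 6, 9); (6, 8, 3)]%N.

(* Main.v *)
(** A law mu of 2Nilp_(2p+1) for which the vectors mu(X_1, X_(2i)) complete X_1,
    X_2, X_4, ..., X_(2p) to a basis has center and derived subalgebra both equal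
    to their span.  A change of basis depending polynomially on mu thus brings mu
    into the linear space W of alternating maps Lambda^2 K^(p+1) -> K^p, and
    everything reduces to the orbits of GL_(p+1) x GL_p on W.  For g5, g7 and g9
    the tangent space of this orbit is the whole of W, which a table of integers
    certifies.  Hence no nonzero polynomial vanishes on the orbit of g in W; the
    orbit being definable by a first-order formula, quantifier elimination shows
    that it contains the complement of a hypersurface.  Pulling this hypersurface
    back along the change of basis gives a neighbourhood of g in 2Nilp_n contained
    in the orbit of g, so g is rigid, and W lies in the closure of the orbit.
    Finally, if ad x has rank p on a (2p+1)-dimensional 2-step nilpotent algebra,
    then x, p vectors y_i and the brackets [x, y_i] form a basis of the above kind,
    so that the algebra is isomorphic to an element of W. *)
Require Import Defs.
From mathcomp Require Import all_boot all_order all_algebra.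
From mathcomp Require Import closed_field mpoly ring.
Set Implicit Arguments.
Unset Strict Implicit.
Unset Printing Implicit Defensive.
Import GRing.Theory.
Local Open Scope ring_scope.

(** * Polynomials along curves *)

(** Uniqueness of base-[D] digits: the lowest digit is the residue modulo [D], and the others follow
    after division by [D]. This is what makes the Kronecker substitution separate monomials. *)
Lemma big_expn_inj n D (a b : 'I_n -> nat) :
  (forall i, a i < D)%N -> (forall i, b i < D)%N ->
  (\sum_i a i * D ^ i = \sum_i b i * D ^ i)%N -> a =1 b.
Proof.
elim: n a b => [|n IHn] a b ltaD ltbD; first by move=> _ [].
have shift (c : 'I_n.+1 -> nat) : (\sum_i c i * D ^ i =
    (\sum_(i < n) c (lift ord0 i) * D ^ i) * D + c ord0)%N.
  rewrite big_ord_recl expn0 muln1 addnC big_distrl /=; congr (_ + _)%N.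
  by apply: eq_bigr => i _; rewrite expnSr mulnA.
rewrite !shift => eqab.
have eq0 : a ord0 = b ord0.
  by have /(congr1 (modn^~ D)) := eqab; rewrite /= !modnMDl !modn_small.
have D_gt0 : (0 < D)%N by apply: leq_ltn_trans (ltaD ord0).
move/eqP: eqab; rewrite eq0 eqn_add2r eqn_pmul2r // => /eqP eqab i.
have /= eqS := IHn _ _ (fun i => ltaD _) (fun i => ltbD _) eqab.
by case: (unliftP ord0 i) => [j|] ->; rewrite ?eqS.
Qed.

(* Kronecker substitution reduces the claim to one variable. *)
Lemma mpoly_neq0_nonroot (K : closedFieldType) N (p : {mpoly K[N]}) :
  p != 0 -> exists v : 'rV[K]_N, p.@[v 0] != 0.
Proof.
(* [D] exceeds the degree of every monomial of [p], so exponents are digits in base [D] and [w m] is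
   the number that they write. *)
move=> p_neq0; pose D := msize p.
pose h (i : 'I_N) : {poly K} := 'X ^+ (D ^ i).
pose w (m : 'X_{1..N}) := (\sum_i m i * D ^ i)%N.
have mmap_h : mmap polyC h p = \sum_(m <- msupp p) p@_m *: 'X ^+ (w m).
  apply: eq_bigr => m _; rewrite mul_polyC; congr (_ *: _).
  by rewrite /mmap1 -prodrXr; apply: eq_bigr => i _; rewrite -exprM mulnC.
have ltD (m : 'X_{1..N}) : m \in msupp p -> forall i, (m i < D)%N.
  move=> /msize_mdeg_lt m_ltD i; apply: leq_ltn_trans m_ltD.
  by rewrite mdegE (bigD1 i) //= leq_addr.
have q_neq0 : mmap polyC h p != 0.
  (* The coefficient at the weight of the leading monomial is the leading coefficient: no other
     monomial of the support has that weight. *)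
  apply/eqP => /(congr1 (fun q : {poly K} => q`_(w (mlead p)))).
  rewrite mmap_h coef0 coef_sum (bigD1_seq (mlead p)) ?msupp_uniq ?mlead_supp //=.
  rewrite coefZ coefXn eqxx mulr1 big1_seq ?addr0.
    by move/eqP; rewrite mleadc_eq0 (negPf p_neq0).
  move=> m /andP[m_neq m_supp]; rewrite coefZ coefXn.
  case: eqP => [eq_w|]; last by rewrite mulr0.
  case/eqP: m_neq; apply/mnmP; apply: (@big_expn_inj _ D); last exact/esym.
    exact: ltD.
  by apply: ltD; apply: mlead_supp.
have /closed_nonrootP[x xP] := q_neq0.
exists (\row_i x ^+ (D ^ i)); apply: contra xP; rewrite /root => /eqP p0.
apply/eqP; rewrite -[RHS]p0 mmap_h horner_sum mevalE.
apply: eq_bigr => m _; rewrite hornerZ hornerXn; congr (_ * _).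
rewrite /w -prodrXr; apply: eq_bigr => i _.
by rewrite !mxE -exprM mulnC.
Qed.

(* The lowest homogeneous component of p governs p along the curve X * u. *)
Lemma mpoly_curve (K : closedFieldType) N (p : {mpoly K[N]}) :
  p != 0 -> exists t : 'rV[K]_N, forall u : 'I_N -> {poly K},
    (forall i, (u i).[0] = t 0 i) -> mmap polyC (fun i => 'X * u i) p != 0.
Proof.
move=> p_neq0.
have ex_d : exists d, has (fun m => mdeg m == d) (msupp p).
  exists (mdeg (mlead p)); apply/hasP; exists (mlead p) => //.
  exact: mlead_supp.
case: (ex_minnP ex_d) => d /hasP[m0 m0_supp /eqP m0d] d_min.
have [t tP] : exists t : 'rV[K]_N, (pihomog mdeg d p).@[t 0] != 0.
  apply: mpoly_neq0_nonroot; apply/eqP => /(congr1 (fun q => q@_m0)).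
  rewrite pihomogE mcoeff0 raddf_sum /= -big_filter.
  rewrite (bigD1_seq m0) ?filter_uniq ?mem_filter ?msupp_uniq ?m0d ?eqxx //=.
  rewrite mcoeffZ mcoeffX eqxx mulr1 big1 ?addr0 => [/eqP|m /negPf m_neq].
    by rewrite mcoeff_eq0 m0_supp.
  by rewrite mcoeffZ mcoeffX m_neq mulr0.
exists t => u u0.
(* [q] is the value along the curve divided by ['X^d], with [d] the lowest degree in [p]. At 0 only
   the monomials of degree [d] survive, so [q.[0]] is the lowest component at [t], whatever the
   higher order terms of [u]. *)
pose q := \sum_(m <- msupp p)
  (p@_m)%:P * ('X ^+ (mdeg m - d) * \prod_i u i ^+ m i).
have -> : mmap polyC (fun i => 'X * u i) p = 'X^d * q.
  rewrite /mmap /q big_distrr /= big_seq [RHS]big_seq.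
  apply: eq_bigr => m m_supp; rewrite mulrCA; congr (_ * _).
  rewrite mulrA -exprD subnKC ?d_min //; last by apply/hasP; exists m.
  rewrite /mmap1 mdegE -prodrXr -big_split /=.
  by apply: eq_bigr => i _; rewrite exprMn.
rewrite mulf_neq0 ?expf_neq0 ?polyX_eq0 //.
apply: contra tP => /eqP q0; apply/eqP.
have <- : q.[0] = 0 by rewrite q0 horner0.
rewrite pihomogE raddf_sum /= horner_sum big_mkcond /=.
rewrite big_seq [RHS]big_seq; apply: eq_bigr => m m_supp.
have le_d : (d <= mdeg m)%N by apply: d_min; apply/hasP; exists m.
rewrite hornerM hornerC hornerM hornerXn horner_prod.
case: eqP => [->|/eqP m_neq].
  rewrite subnn expr0 mul1r mevalZ mevalX; congr (_ * _).
  by apply: eq_bigr => i _; rewrite horner_exp u0.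
have : (0 < mdeg m - d)%N by rewrite subn_gt0 ltn_neqAle eq_sym m_neq.
by case: (mdeg m - d)%N => // k _; rewrite expr0n mul0r mulr0.
Qed.

Lemma horner_mmap (K : comNzRingType) N (h : 'I_N -> {poly K})
    (p : {mpoly K[N]}) x :
  (mmap polyC h p).[x] = p.@[fun i => (h i).[x]].
Proof.
rewrite mevalE horner_sum; apply: eq_bigr => m _.
rewrite hornerM hornerC horner_prod; congr (_ * _).
by apply: eq_bigr => i _; rewrite horner_exp.
Qed.

(** * Polynomial maps and generic truth *)

Section PolynomialMaps.

Variables (K : fieldType) (N : nat).
Implicit Types phi psi : 'rV[K]_N -> K.

(** Regularity is an existence statement about functions, so that polynomials built from
    determinants and brackets never have to be written down. *)
Definition polyfun phi :=
  exists p : {mpoly K[N]}, forall v, phi v = p.@[v 0].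

Lemma eq_polyfun phi psi : phi =1 psi -> polyfun phi -> polyfun psi.
Proof. by move=> eq_phi [p pP]; exists p => v; rewrite -eq_phi. Qed.

Lemma polyfun_const c : polyfun (fun=> c).
Proof. by exists c%:MP => v; rewrite mevalC. Qed.

Lemma polyfun_coord j : polyfun (fun v => v 0 j).
Proof. by exists 'X_j => v; rewrite mevalXU. Qed.

Lemma polyfunD phi psi :
  polyfun phi -> polyfun psi -> polyfun (fun v => phi v + psi v).
Proof. by move=> [p pP] [q qP]; exists (p + q) => v; rewrite mevalD pP qP. Qed.

Lemma polyfunM phi psi :
  polyfun phi -> polyfun psi -> polyfun (fun v => phi v * psi v).
Proof. by move=> [p pP] [q qP]; exists (p * q) => v; rewrite mevalM pP qP. Qed.

Lemma polyfunN phi : polyfun phi -> polyfun (fun v => - phi v).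
Proof. by move=> [p pP]; exists (- p) => v; rewrite mevalN pP. Qed.

Lemma polyfunMn phi k : polyfun phi -> polyfun (fun v => phi v *+ k).
Proof. by move=> [p pP]; exists (p *+ k) => v; rewrite mevalMn pP. Qed.

Lemma polyfunX phi k : polyfun phi -> polyfun (fun v => phi v ^+ k).
Proof. by move=> [p pP]; exists (p ^+ k) => v; rewrite rmorphXn pP. Qed.

Lemma polyfun_sum (I : Type) (r : seq I) (P : pred I) (F : I -> 'rV[K]_N -> K) :
  (forall i, polyfun (F i)) -> polyfun (fun v => \sum_(i <- r | P i) F i v).
Proof.
move=> polyF; elim: r => [|i r IHr].
  by apply: eq_polyfun (polyfun_const 0) => v; rewrite big_nil.
apply: (@eq_polyfun (fun v => (if P i then F i v else 0) +
                              \sum_(j <- r | P j) F j v)) => [v|].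
  by rewrite big_cons; case: ifP; rewrite ?add0r.
apply: polyfunD IHr; case: (P i) => //; exact: polyfun_const.
Qed.

Lemma polyfun_prod (I : Type) (r : seq I) (P : pred I) (F : I -> 'rV[K]_N -> K) :
  (forall i, polyfun (F i)) -> polyfun (fun v => \prod_(i <- r | P i) F i v).
Proof.
move=> polyF; elim: r => [|i r IHr].
  by apply: eq_polyfun (polyfun_const 1) => v; rewrite big_nil.
apply: (@eq_polyfun (fun v => (if P i then F i v else 1) *
                              \prod_(j <- r | P j) F j v)) => [v|].
  by rewrite big_cons; case: ifP; rewrite ?mul1r.
apply: polyfunM IHr; case: (P i) => //; exact: polyfun_const.
Qed.

Lemma polyfun_meval M (p : {mpoly K[M]}) (h : 'rV[K]_N -> 'rV[K]_M) :
  (forall i, polyfun (fun v => h v 0 i)) -> polyfun (fun v => p.@[h v 0]).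
Proof.
move=> polyh; apply: (@eq_polyfun (fun v => \sum_(m <- msupp p)
    p@_m * \prod_i h v 0 i ^+ m i)) => [v|]; first by rewrite mevalE.
apply: polyfun_sum => m; apply: polyfunM; first exact: polyfun_const.
by apply: polyfun_prod => i; apply: polyfunX.
Qed.

Definition polymx a b (f : 'rV[K]_N -> 'M[K]_(a, b)) :=
  forall i j, polyfun (fun v => f v i j).

Lemma polymx_const a b (A : 'M[K]_(a, b)) : polymx (fun=> A).
Proof. by move=> i j; apply: polyfun_const. Qed.

Lemma polymx_id : polymx id.
Proof. by move=> i j; rewrite ord1; apply: polyfun_coord. Qed.

Lemma polymxD a b (f g : 'rV[K]_N -> 'M[K]_(a, b)) :
  polymx f -> polymx g -> polymx (fun v => f v + g v).
Proof.
move=> pf pg i j; apply: eq_polyfun (polyfunD (pf i j) (pg i j)) => v.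
by rewrite mxE.
Qed.

Lemma polymxN a b (f : 'rV[K]_N -> 'M[K]_(a, b)) :
  polymx f -> polymx (fun v => - f v).
Proof.
by move=> pf i j; apply: eq_polyfun (polyfunN (pf i j)) => v; rewrite mxE.
Qed.

Lemma polymxM a b c (f : 'rV[K]_N -> 'M[K]_(a, b)) (g : 'rV[K]_N -> 'M[K]_(b, c)) :
  polymx f -> polymx g -> polymx (fun v => f v *m g v).
Proof.
move=> pf pg i j.
apply: (@eq_polyfun (fun v => \sum_k f v i k * g v k j)) => [v|].
  by rewrite mxE.
by apply: polyfun_sum => k; apply: polyfunM.
Qed.

Lemma polymx_trmx a b (f : 'rV[K]_N -> 'M[K]_(a, b)) :
  polymx f -> polymx (fun v => (f v)^T).
Proof. by move=> pf i j; apply: eq_polyfun (pf j i) => v; rewrite mxE. Qed.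

Lemma polymx_mxvec a b (f : 'rV[K]_N -> 'M[K]_(a, b)) :
  polymx f -> polymx (fun v => mxvec (f v)).
Proof.
move=> pf i j; rewrite ord1; case/mxvec_indexP: j => k l.
by apply: eq_polyfun (pf k l) => v; rewrite mxvecE.
Qed.

Lemma polymx_vec_mx a b (f : 'rV[K]_N -> 'rV[K]_(a * b)) :
  polymx f -> polymx (fun v => vec_mx (f v)).
Proof.
by move=> pf i j; apply: eq_polyfun (pf 0 (mxvec_index i j)) => v; rewrite mxE.
Qed.

Lemma polymx_lsubmx a b c (f : 'rV[K]_N -> 'M[K]_(a, b + c)) :
  polymx f -> polymx (fun v => lsubmx (f v)).
Proof.
by move=> pf i j; apply: eq_polyfun (pf i (lshift c j)) => v; rewrite mxE.
Qed.

Lemma polymx_rsubmx a b c (f : 'rV[K]_N -> 'M[K]_(a, b + c)) :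
  polymx f -> polymx (fun v => rsubmx (f v)).
Proof.
by move=> pf i j; apply: eq_polyfun (pf i (rshift b j)) => v; rewrite mxE.
Qed.

Lemma polyfun_det a (f : 'rV[K]_N -> 'M[K]_a) :
  polymx f -> polyfun (fun v => \det (f v)).
Proof.
move=> pf; apply: polyfun_sum => s; apply: polyfunM; first exact: polyfun_const.
by apply: polyfun_prod => i; apply: pf.
Qed.

(** Entries of the adjugate are signed minors. The adjugate later replaces an inverse matrix, which
    would not depend polynomially on the law. *)
Lemma polymx_adj a (f : 'rV[K]_N -> 'M[K]_a) :
  polymx f -> polymx (fun v => \adj (f v)).
Proof.
move=> pf i j; apply: (@eq_polyfun (fun v => cofactor (f v) j i)) => [v|].
  by rewrite mxE.
apply: polyfunM; first exact: polyfun_const.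
apply: polyfun_det => k l.
by apply: eq_polyfun (pf (lift j k) (lift i l)) => v; rewrite !mxE.
Qed.

End PolynomialMaps.

(** * Generic truth of first-order formulas over an algebraically closed field *)

Section GenericTruth.

Variable K : closedFieldType.

(** The condition [rterm] excludes inverses, the only term constructor that is not polynomial. *)
Lemma rterm_polyfun N (t : GRing.term K) : GRing.rterm t ->
  polyfun (fun v : 'rV[K]_N => GRing.eval [seq v 0 i | i <- enum 'I_N] t).
Proof.
elim: t => //=.
- move=> k _; case: (ltnP k N) => [ltkN|leNk].
    apply: eq_polyfun (polyfun_coord _ (Ordinal ltkN)) => v.
    rewrite (nth_map (Ordinal ltkN)) ?size_enum_ord //.
    by congr (v 0 _); apply: val_inj; rewrite /= nth_enum_ord.
  (* A variable beyond the environment evaluates to the default 0. *)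
  apply: eq_polyfun (polyfun_const _ 0) => v.
  by rewrite nth_default // size_map size_enum_ord.
- by move=> x _; apply: polyfun_const.
- by move=> x _; apply: polyfun_const.
- by move=> t1 IH1 t2 IH2 /andP[/IH1 p1 /IH2 p2]; apply: polyfunD.
- by move=> t1 IH1 /IH1; apply: polyfunN.
- by move=> t1 IH1 k /IH1; apply: polyfunMn.
- by move=> t1 IH1 t2 IH2 /andP[/IH1 p1 /IH2 p2]; apply: polyfunM.
- by move=> t1 IH1 k /IH1; apply: polyfunX.
Qed.

(* A quantifier-free formula is a boolean combination of polynomial equations,
   each of which is generically true or generically false. *)
Lemma generic_qf_eval N (f : GRing.formula K) :
    GRing.qf_form f -> GRing.rformula f ->
  exists2 p : {mpoly K[N]}, p != 0 & exists b, forall v : 'rV[K]_N,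
    p.@[v 0] != 0 -> GRing.qf_eval [seq v 0 i | i <- enum 'I_N] f = b.
Proof.
have binary f1 f2 (op : bool -> bool -> bool) :
    (exists2 p : {mpoly K[N]}, p != 0 & exists b, forall v : 'rV[K]_N,
      p.@[v 0] != 0 -> GRing.qf_eval [seq v 0 i | i <- enum 'I_N] f1 = b) ->
    (exists2 p : {mpoly K[N]}, p != 0 & exists b, forall v : 'rV[K]_N,
      p.@[v 0] != 0 -> GRing.qf_eval [seq v 0 i | i <- enum 'I_N] f2 = b) ->
    exists2 p : {mpoly K[N]}, p != 0 & exists b, forall v : 'rV[K]_N,
      p.@[v 0] != 0 -> op (GRing.qf_eval [seq v 0 i | i <- enum 'I_N] f1)
                          (GRing.qf_eval [seq v 0 i | i <- enum 'I_N] f2) = b.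
  move=> [p1 p1_neq0 [b1 b1P]] [p2 p2_neq0 [b2 b2P]].
  exists (p1 * p2); first by rewrite mulf_neq0.
  exists (op b1 b2) => v; rewrite mevalM mulf_eq0 negb_or => /andP[v1 v2].
  by rewrite b1P // b2P.
elim: f => //=.
- by move=> b _ _; exists 1; [apply: oner_neq0 | exists b].
- move=> t1 t2 _ /andP[/(rterm_polyfun N)[q1 q1P] /(rterm_polyfun N)[q2 q2P]].
  have [/eqP eq_q|neq_q] := boolP (q1 == q2).
    exists 1; first exact: oner_neq0.
    by exists true => v _; rewrite q1P q2P eq_q eqxx.
  exists (q1 - q2); first by rewrite subr_eq0.
  by exists false => v; rewrite mevalB subr_eq0 q1P q2P => /negPf.
- move=> f1 IH1 f2 IH2 /andP[q1 q2] /andP[r1 r2].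
  exact: binary (IH1 q1 r1) (IH2 q2 r2).
- move=> f1 IH1 f2 IH2 /andP[q1 q2] /andP[r1 r2].
  exact: binary (IH1 q1 r1) (IH2 q2 r2).
- move=> f1 IH1 f2 IH2 /andP[q1 q2] /andP[r1 r2].
  exact: binary (IH1 q1 r1) (IH2 q2 r2).
- move=> f1 IH1 q1 r1.
  (* Negation is treated as a binary connective that ignores its second argument. *)
  exact: (binary f1 f1 (fun b _ => ~~ b)) (IH1 q1 r1) (IH1 q1 r1).
Qed.

(** The translation in the other direction: polynomial equations become first-order formulas, to
    which quantifier elimination applies. *)
Lemma mpoly_rterm M (p : {mpoly K[M]}) : exists2 t : GRing.term K,
  GRing.rterm t & forall e, GRing.eval e t = p.@[fun i => e`_i].
Proof.
pose realized q := exists2 t : GRing.term K,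
  GRing.rterm t & forall e, GRing.eval e t = q.@[fun i : 'I_M => e`_i].
have realizedM q r : realized q -> realized r -> realized (q * r).
  move=> [t tr tE] [u ur uE]; exists (GRing.Mul t u); first exact/andP.
  by move=> e; rewrite mevalM /= tE uE.
have realizedC c : realized c%:MP.
  by exists (GRing.Const c) => // e; rewrite mevalC.
rewrite -/(realized p) (mpolyE p).
elim/big_ind: _ => [|q r [t tr tE] [u ur uE]|m _].
- by rewrite -mpolyC0; apply: realizedC.
- exists (GRing.Add t u); first exact/andP.
  by move=> e; rewrite mevalD /= tE uE.
rewrite -mul_mpolyC; apply: (realizedM _ _ (realizedC _)).
rewrite mpolyXE_id; apply: (big_ind realized _ realizedM) => [|i _].
  by rewrite -mpolyC1; apply: realizedC.
exists (GRing.Exp (GRing.Var K i) (m i)) => // e.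
by rewrite rmorphXn /= mevalXU.
Qed.

(** A form of Chevalley's theorem. Solvability in [w] is a first-order condition on [v]; once its
    quantifiers are eliminated, it is generically constant by [generic_qf_eval]. *)
Lemma generic_projection N M (r : seq ('rV[K]_(N + M) -> K)) :
    (forall i, polyfun (nth (fun=> 0) r i)) ->
  exists2 p : {mpoly K[N]}, p != 0 & exists b : bool, forall v : 'rV[K]_N,
    p.@[v 0] != 0 ->
    ((exists w : 'rV[K]_M, forall i, nth (fun=> 0) r i (row_mx v w) = 0) <-> b).
Proof.
move=> polyr.
have [f [rf fP]] : exists f : GRing.formula K, GRing.rformula f /\
    forall e, GRing.holds e f <->
      forall i, nth (fun=> 0) r i (\row_(j < N + M) e`_j) = 0.
  elim: r polyr => [|phi r IHr] polyr.
    by exists (GRing.Bool true); split=> // e; split=> // _ i; rewrite nth_nil.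
  have [|f [rf fP]] := IHr; first by move=> i; apply: (polyr i.+1).
  have [/= p pP] := polyr 0%N; have [t rt tE] := mpoly_rterm p.
  exists (GRing.And (GRing.Equal t (GRing.NatConst K 0)) f) => /=.
  rewrite rt rf; split=> // e.
  have <- : phi (\row_(j < N + M) e`_j) = GRing.eval e t.
    by rewrite pP tE; apply: meval_eq => i; rewrite mxE.
  split=> [[phi0 /fP r0] [|i] //=|phir0].
  by split; [apply: (phir0 0%N) | apply/fP => i; apply: (phir0 i.+1)].
(* The variables [N], ..., [N + M - 1] are the coordinates of [w]; those of [v] stay free. *)
pose g := foldr (@GRing.Exists K) f (iota N M).
have rg : GRing.rformula g by rewrite /g; elim: (iota N M).
pose elim_g := GRing.quantifier_elim (@ClosedFieldQE.ex_elim K) g.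
have gP e : reflect (GRing.holds e g) (GRing.qf_eval e elim_g).
  apply: GRing.quantifier_elim_rformP rg; first exact: ClosedFieldQE.wf_ex_elim.
  by apply: ClosedFieldQE.holds_ex_elim; apply: GRing.solve_monicpoly.
have /andP[qf_elim r_elim] :=
  GRing.quantifier_elim_wf (@ClosedFieldQE.wf_ex_elim K) rg.
have [p p_neq0 [b bP]] := generic_qf_eval N qf_elim r_elim.
exists p => //; exists b => v /bP <-; pose e := [seq v 0 i | i <- enum 'I_N].
have nth_e (i : 'I_N) : e`_i = v 0 i.
  by rewrite (nth_map i) ?size_enum_ord // nth_ord_enum.
split=> [[w wP] | /gP/GRing.foldExistsP[e' eq_e /fP e'P]].
  (* The witness is [v] followed by [w]. It agrees with [e] outside the bound variables, both being
     0 from [N + M] on. *)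
  apply/gP/GRing.foldExistsP; exists (e ++ [seq w 0 i | i <- enum 'I_M]).
    move=> k; rewrite inE mem_iota negb_and -ltnNge -leqNgt nth_cat => /orP[ltkN|leNMk].
      by rewrite size_map size_enum_ord ltkN.
    have leNk := leq_trans (leq_addr M N) leNMk.
    rewrite size_map size_enum_ord ltnNge leNk /=.
    by rewrite !nth_default // size_map size_enum_ord ?leq_subRL.
  apply/fP => i; rewrite -[RHS](wP i); congr (nth _ r i _).
  apply/rowP => j; rewrite !mxE nth_cat size_map size_enum_ord.
  case: splitP => k ->; first by rewrite nth_e.
  by rewrite addKn (nth_map k) ?size_enum_ord // nth_ord_enum.
exists (\row_j e'`_(N + j)) => i; rewrite -[RHS](e'P i); congr (nth _ r i _).
apply/rowP => j; rewrite !mxE.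
case: splitP => k ->; last by rewrite mxE.
by rewrite -nth_e eq_e // inE mem_iota negb_and -ltnNge ltn_ord.
Qed.

End GenericTruth.

(** * Laws *)

Lemma generic_projection_mx (K : closedFieldType) N M L
    (phi : 'rV[K]_(N + M) -> 'rV[K]_L) :
    polymx phi ->
  exists2 p : {mpoly K[N]}, p != 0 & exists b : bool, forall v : 'rV[K]_N,
    p.@[v 0] != 0 -> ((exists w : 'rV[K]_M, phi (row_mx v w) = 0) <-> b).
Proof.
move=> polyphi; pose r := [seq (fun v => phi v 0 j) | j <- enum 'I_L].
have nthr i v : nth (fun=> 0) r i v = if insub i is Some j then phi v 0 j else 0.
  case: insubP => [j lt_i eq_j|].
    by rewrite -eq_j (nth_map j) ?size_enum_ord //= nth_ord_enum.
  by rewrite -leqNgt => leLi; rewrite nth_default // size_map size_enum_ord.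
have [i|p p_neq0 [b bP]] := @generic_projection K N M r.
  apply: eq_polyfun (fun v => esym (nthr i v)) _.
  by case: insub => [j|]; [apply: polyphi | apply: polyfun_const].
exists p => //; exists b => v /bP <-.
split=> -[w wP]; exists w; first move=> i.
  by rewrite nthr wP; case: insub => // j; rewrite mxE.
apply/rowP => j; rewrite mxE.
by have := wP j; rewrite nthr insubT //= => lt_j; congr (phi _ 0 _ = 0); apply: val_inj.
Qed.

Section BilinearLaws.

Variables (K : fieldType) (n : nat).
Implicit Types (mu nu : law K n) (x y z : 'rV[K]_n) (f h A : 'M[K]_n).

Lemma bracketDl mu x y z : bracket mu (x + y) z = bracket mu x z + bracket mu y z.
Proof. by rewrite /bracket raddfD mulmxDl raddfD mulmxDl. Qed.

Lemma bracketDr mu x y z : bracket mu x (y + z) = bracket mu x y + bracket mu x z.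
Proof. by rewrite /bracket mulmxDr raddfD mulmxDl. Qed.

Lemma bracketZl mu c x y : bracket mu (c *: x) y = c *: bracket mu x y.
Proof. by rewrite /bracket linearZ -scalemxAl linearZ -scalemxAl. Qed.

Lemma bracketZr mu c x y : bracket mu x (c *: y) = c *: bracket mu x y.
Proof. by rewrite /bracket -scalemxAr linearZ -scalemxAl. Qed.

Lemma bracket0l mu y : bracket mu 0 y = 0.
Proof. by have := bracketZl mu 0 0 y; rewrite !scale0r. Qed.

Lemma bracket0r mu x : bracket mu x 0 = 0.
Proof. by have := bracketZr mu 0 x 0; rewrite !scale0r. Qed.

Lemma bracket_suml mu (I : Type) (r : seq I) (P : pred I) F y :
  bracket mu (\sum_(i <- r | P i) F i) y = \sum_(i <- r | P i) bracket mu (F i) y.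
Proof.
by apply: (big_morph (bracket mu ^~ y)) => [u v|]; rewrite ?bracketDl ?bracket0l.
Qed.

Lemma bracket_sumr mu (I : Type) (r : seq I) (P : pred I) F x :
  bracket mu x (\sum_(i <- r | P i) F i) = \sum_(i <- r | P i) bracket mu x (F i).
Proof.
by apply: (big_morph (bracket mu x)) => [u v|]; rewrite ?bracketDr ?bracket0r.
Qed.

Lemma bracket_lawD mu nu x y : bracket (mu + nu) x y = bracket mu x y + bracket nu x y.
Proof. exact: mulmxDr. Qed.

Lemma bracket_lawZ c mu x y : bracket (c *: mu) x y = c *: bracket mu x y.
Proof. by rewrite /bracket -scalemxAr. Qed.

Lemma bracket_delta mu i j :
  bracket mu (delta_mx 0 i) (delta_mx 0 j) = row (mxvec_index i j) mu.
Proof. by rewrite /bracket trmx_delta mul_delta_mx mxvec_delta -rowE. Qed.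

Lemma bracketE mu x y :
  bracket mu x y = \sum_i \sum_j (x 0 i * y 0 j) *: row (mxvec_index i j) mu.
Proof.
rewrite [x in LHS]row_sum_delta bracket_suml; apply: eq_bigr => i _.
rewrite bracketZl [y in LHS]row_sum_delta bracket_sumr scaler_sumr.
by apply: eq_bigr => j _; rewrite bracketZr scalerA bracket_delta.
Qed.

Lemma eq_law mu nu : bracket mu =2 bracket nu -> mu = nu.
Proof.
move=> eq_mu; apply/row_matrixP => k; case/mxvec_indexP: k => i j.
by rewrite -!bracket_delta eq_mu.
Qed.

Definition bilinear_op (B : 'rV[K]_n -> 'rV[K]_n -> 'rV[K]_n) :=
  (forall (c : K) x y z, B (c *: x + y) z = c *: B x z + B y z) /\
  (forall (c : K) x y z, B z (c *: x + y) = c *: B z x + B z y).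

Lemma law_ofE (B : 'rV[K]_n -> 'rV[K]_n -> 'rV[K]_n) i j k :
  law_of B (mxvec_index i j) k = B (delta_mx 0 i) (delta_mx 0 j) 0 k.
Proof. by rewrite !mxE mxvecE mxE. Qed.

Lemma bracket_law_of B : bilinear_op B -> bracket (law_of B) =2 B.
Proof.
move=> [Bl Br] x y.
have Bl0 z : B 0 z = 0.
  by have := Bl 1 0 0 z; rewrite !scale1r addr0 -{1}[B 0 z]addr0 => /addrI <-.
have Br0 z : B z 0 = 0.
  by have := Br 1 0 0 z; rewrite !scale1r addr0 -{1}[B z 0]addr0 => /addrI <-.
have -> : B x y = \sum_i \sum_j (x 0 i * y 0 j) *: B (delta_mx 0 i) (delta_mx 0 j).
  rewrite [x in LHS]row_sum_delta.
  rewrite (big_morph (B^~ y) (id1 := 0) (op1 := +%R)) => [|u v|] //; last first.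
    by have := Bl 1 u v y; rewrite !scale1r.
  apply: eq_bigr => i _; have := Bl (x 0 i) (delta_mx 0 i) 0 y.
  rewrite Bl0 !addr0 => ->; rewrite [y in LHS]row_sum_delta.
  rewrite (big_morph (B _) (id1 := 0) (op1 := +%R)) => [|u v|] //; last first.
    by have := Br 1 u v (delta_mx 0 i); rewrite !scale1r.
  rewrite scaler_sumr; apply: eq_bigr => j _.
  have := Br (y 0 j) (delta_mx 0 j) 0 (delta_mx 0 i).
  by rewrite Br0 !addr0 => ->; rewrite scalerA.
rewrite bracketE; apply: eq_bigr => i _; apply: eq_bigr => j _; congr (_ *: _).
by apply/rowP => k; rewrite mxE law_ofE.
Qed.

(** A form of [act] in which [h] is independent of [f]: it is polynomial in [mu], [f] and [h]
    jointly, and also expresses separate changes of basis on arguments and values. *)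
Definition twist mu f h : law K n :=
  law_of (fun x y => bracket mu (x *m f) (y *m f) *m h).

Lemma bracket_twist mu f h x y :
  bracket (twist mu f h) x y = bracket mu (x *m f) (y *m f) *m h.
Proof.
apply: bracket_law_of; split=> c u v w.
  by rewrite mulmxDl -scalemxAl bracketDl bracketZl mulmxDl -scalemxAl.
by rewrite mulmxDl -scalemxAl bracketDr bracketZr mulmxDl -scalemxAl.
Qed.

Lemma bracket_act f mu x y :
  bracket (act f mu) x y = bracket mu (x *m f) (y *m f) *m invmx f.
Proof. exact: bracket_twist. Qed.

Lemma act_comp f h mu : f \in unitmx -> h \in unitmx ->
  act h (act f mu) = act (h *m f) mu.
Proof.
move=> uf uh; apply: eq_law => x y; rewrite !bracket_act !mulmxA.
rewrite -[LHS]mulmxA; congr (_ *m _).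
have uhf : h *m f \in unitmx by rewrite unitmx_mul uh.
apply: (can_inj (mulKmx uhf)); rewrite mulmxV //.
by rewrite mulmxA mulmxK // mulmxV.
Qed.

Lemma act1 mu : act 1%:M mu = mu.
Proof. by apply: eq_law => x y; rewrite bracket_act invmx1 !mulmx1. Qed.

Lemma law_orbit_trans mu nu rho :
  law_orbit mu nu -> law_orbit nu rho -> law_orbit mu rho.
Proof.
move=> [f uf ->] [h uh ->]; exists (h *m f); first by rewrite unitmx_mul uh.
by rewrite act_comp.
Qed.

Lemma law_orbit_sym mu nu : law_orbit mu nu -> law_orbit nu mu.
Proof.
move=> [f uf ->]; exists (invmx f); first by rewrite unitmx_inv.
by rewrite act_comp ?unitmx_inv // mulVmx // act1.
Qed.

Lemma two_nilp_orbit mu nu : law_orbit mu nu -> two_nilp mu -> two_nilp nu.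
Proof.
move=> [f uf ->] [skew nilp]; split=> [x y|x y z].
  by rewrite !bracket_act skew mulNmx.
by rewrite !bracket_act mulmxKV // nilp mul0mx.
Qed.

Lemma two_nilp_Lie mu : two_nilp mu -> is_Lie mu.
Proof. by move=> [skew nilp]; split=> // x y z; rewrite !nilp !addr0. Qed.

(** A homothety of ratio [c] scales both arguments by [c] and the value by the inverse of [c]. *)
Lemma law_orbit_scale c mu : c != 0 -> law_orbit mu (c *: mu).
Proof.
move=> c_neq0; exists c%:M; first by rewrite unitmxE det_scalar unitfE expf_neq0.
apply: eq_law => x y; rewrite bracket_act bracket_lawZ !mul_mx_scalar.
by rewrite bracketZl bracketZr invmx_scalar mul_mx_scalar scalerK.
Qed.

End BilinearLaws.

Section PolynomialLaws.

Variables (K : fieldType) (N n : nat).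

Lemma polymx_bracket (mu : 'rV[K]_N -> law K n) (x y : 'rV[K]_N -> 'rV[K]_n) :
  polymx mu -> polymx x -> polymx y ->
  polymx (fun v => bracket (mu v) (x v) (y v)).
Proof.
move=> pmu px py; apply: polymxM => //; apply: polymx_mxvec.
by apply: polymxM => //; apply: polymx_trmx.
Qed.

Lemma polymx_law_of (B : 'rV[K]_N -> 'rV[K]_n -> 'rV[K]_n -> 'rV[K]_n) :
  (forall x y, polymx (fun v => B v x y)) -> polymx (fun v => law_of (B v)).
Proof.
move=> pB k l; case/mxvec_indexP: k => i j.
apply: eq_polyfun (pB (delta_mx 0 i) (delta_mx 0 j) 0 l) => v.
by rewrite law_ofE.
Qed.

Lemma polymx_twist (mu : 'rV[K]_N -> law K n) (f h : 'rV[K]_N -> 'M[K]_n) :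
  polymx mu -> polymx f -> polymx h -> polymx (fun v => twist (mu v) (f v) (h v)).
Proof.
move=> pmu pf ph; apply: polymx_law_of => x y; apply: polymxM => //.
by apply: polymx_bracket => //; apply: polymxM => //; apply: polymx_const.
Qed.

End PolynomialLaws.

(** * Split laws *)

Section SplitLaws.

Variables (K : fieldType) (n : nat) (z : pred 'I_n).
Implicit Types (w mu : law K n) (x y : 'rV[K]_n) (f A B : 'M[K]_n).

Definition proj_mx (P : pred 'I_n) : 'M[K]_n := diag_mx (\row_i (P i)%:R).
Definition projZ := proj_mx z.
Definition projE := proj_mx (predC z).

Lemma mul_proj_mx P Q : proj_mx P *m proj_mx Q = proj_mx (predI P Q).
Proof.
rewrite mulmx_diag; congr diag_mx; apply/rowP => i.
by rewrite !mxE -natrM mulnb.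
Qed.

Lemma mulmx_projE P m (x : 'M[K]_(m, n)) i j :
  (x *m proj_mx P) i j = x i j * (P j)%:R.
Proof. by rewrite mul_mx_diag !mxE. Qed.

Lemma proj_mx0 P : P =1 xpred0 -> proj_mx P = 0.
Proof. by move=> P0; apply/matrixP => i j; rewrite !mxE P0 mul0rn. Qed.

Lemma projZZ : projZ *m projZ = projZ.
Proof. by rewrite mul_proj_mx; congr diag_mx; apply/rowP => i; rewrite !mxE /= andbb. Qed.

Lemma projEE : projE *m projE = projE.
Proof. by rewrite mul_proj_mx; congr diag_mx; apply/rowP => i; rewrite !mxE /= andbb. Qed.

Lemma projZE : projZ *m projE = 0.
Proof. by rewrite mul_proj_mx proj_mx0 // => i /=; rewrite andbN. Qed.

Lemma projED : projE + projZ = 1%:M.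
Proof.
apply/matrixP => i j; rewrite !mxE -mulrnDl /=; case: (z i) => /=.
  by rewrite add0r.
by rewrite addr0.
Qed.

(* The laws with values in the span of the basis vectors of index in z, which
   they annihilate. *)
Definition split_law w : Prop := skew_symmetric w /\
  forall x y, bracket w x y = bracket w (x *m projE) (y *m projE) *m projZ.

(** [1%:M + A] fixes the basis vectors of index in [z], and [1%:M + B] those of index outside [z].
    When invertible, they represent the two factors of the product of linear groups acting on split
    laws. *)
Definition blockE A := projE *m A *m projE = A.
Definition blockZ B := projZ *m B *m projZ = B.

Lemma split_lawZ w : split_law w -> forall x y, bracket w x y *m projZ = bracket w x y.
Proof. by move=> [_ wP] x y; rewrite [in LHS]wP -mulmxA projZZ -wP. Qed.

Lemma split_lawE w : split_law w -> forall x y x' y',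
  x *m projE = x' *m projE -> y *m projE = y' *m projE ->
  bracket w x y = bracket w x' y'.
Proof. by move=> [_ wP] x y x' y' ex ey; rewrite wP ex ey -wP. Qed.

Lemma split_law_two_nilp w : split_law w -> two_nilp w.
Proof.
move=> wW; split=> [|x y t]; first exact: wW.1.
rewrite -(split_lawZ wW x y) wW.2 -(mulmxA _ projZ) projZE mulmx0.
by rewrite bracket0l mul0mx.
Qed.

Lemma split_law_scale c w : split_law w -> split_law (c *: w).
Proof.
move=> [sw wP]; split=> x y; rewrite !bracket_lawZ; first by rewrite sw scalerN.
by rewrite wP -scalemxAl.
Qed.

Lemma blockE_add A : blockE A -> forall x,
  x *m (1%:M + A) *m projE = x *m projE *m (1%:M + A).
Proof.
move=> <- x; rewrite !mulmxDr !mulmxDl !mulmx1 !mulmxA; congr (_ + _).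
by rewrite -!(mulmxA _ projE projE) projEE.
Qed.

Lemma blockZ_add B : blockZ B ->
  projZ *m (1%:M + B) *m projZ = projZ *m (1%:M + B).
Proof.
move=> ZB; rewrite mulmxDr mulmxDl mulmx1 projZZ ZB; congr (_ + _).
by rewrite -[in RHS]ZB !mulmxA projZZ ZB.
Qed.

Lemma split_law_twist w A B : blockE A -> blockZ B -> split_law w ->
  split_law (twist w (1%:M + A) (1%:M + B)).
Proof.
move=> EA ZB wW; split=> x y; rewrite !bracket_twist.
  by rewrite wW.1 mulNmx.
have -> : bracket w (x *m projE *m (1%:M + A)) (y *m projE *m (1%:M + A)) =
          bracket w (x *m (1%:M + A)) (y *m (1%:M + A)).
  by apply: split_lawE; rewrite // -blockE_add // -!mulmxA projEE.
rewrite -(split_lawZ wW); move: (bracket w _ _) => b; rewrite -!mulmxA.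
by rewrite [projZ *m (_ *m projZ)]mulmxA blockZ_add.
Qed.

(** The change of basis is [1 + A] followed by the inverse of [1 + B]. The latter is the identity
    modulo the span of [z], so the arguments see only [1 + A]; on that span the inverse of [1 + A]
    is the identity, so the values see only [1 + B]. *)
Lemma law_orbit_twist w A B : split_law w -> blockE A -> blockZ B ->
    1%:M + A \in unitmx -> 1%:M + B \in unitmx ->
  law_orbit w (twist w (1%:M + A) (1%:M + B)).
Proof.
move=> wW EA ZB uA uB; exists ((1%:M + A) *m invmx (1%:M + B)).
  by rewrite unitmx_mul uA unitmx_inv.
apply: eq_law => x y; rewrite bracket_act bracket_twist.
have invBE : invmx (1%:M + B) *m projE = projE.
  apply: (can_inj (mulKmx uB)); rewrite mulmxA mulmxV // mul1mx.
  by rewrite mulmxDl mul1mx -ZB -(mulmxA _ projZ projE) projZE mulmx0 addr0.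
have -> : bracket w (x *m ((1%:M + A) *m invmx (1%:M + B)))
                    (y *m ((1%:M + A) *m invmx (1%:M + B))) =
          bracket w (x *m (1%:M + A)) (y *m (1%:M + A)).
  by apply: split_lawE; rewrite // -!mulmxA invBE.
have -> : invmx ((1%:M + A) *m invmx (1%:M + B)) = (1%:M + B) *m invmx (1%:M + A).
  have uAB : (1%:M + A) *m invmx (1%:M + B) \in unitmx.
    by rewrite unitmx_mul uA unitmx_inv.
  apply: (can_inj (mulKmx uAB)); rewrite mulmxV //.
  by rewrite mulmxA mulmxKV // mulmxV.
have ZinvA : projZ *m invmx (1%:M + A) = projZ.
  apply: (can_inj (mulmxK uA)); rewrite mulmxKV //.
  by rewrite mulmxDr mulmx1 -EA !mulmxA projZE !mul0mx addr0.
rewrite -(split_lawZ wW); move: (bracket w _ _) => b.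
rewrite -!(mulmxA b); congr (b *m _).
by rewrite mulmxA -blockZ_add // -(mulmxA _ projZ (invmx _)) ZinvA.
Qed.

(** A linear map from all structure constants to split laws. It parametrizes the split laws by the
    ambient affine space, where genericity is expressed by polynomials. Without a factor 1/2 in the
    antisymmetrization, it doubles a split law instead of fixing it. *)
Definition split_part mu : law K n :=
  law_of (fun x y => (bracket mu (x *m projE) (y *m projE)
                      - bracket mu (y *m projE) (x *m projE)) *m projZ).

Lemma bracket_split_part mu x y : bracket (split_part mu) x y =
  (bracket mu (x *m projE) (y *m projE)
   - bracket mu (y *m projE) (x *m projE)) *m projZ.
Proof.
apply: (@bracket_law_of K n (fun x y => (bracket mu (x *m projE) (y *m projE)
                      - bracket mu (y *m projE) (x *m projE)) *m projZ)).
split=> c u v t; rewrite !mulmxDl -!scalemxAl !(bracketDl, bracketDr);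
  rewrite !(bracketZl, bracketZr) !mulNmx !mulmxDl -!scalemxAl;
  by rewrite opprD scalerBr addrACA.
Qed.

Lemma split_part_split mu : split_law (split_part mu).
Proof.
split=> x y; rewrite !bracket_split_part; first by rewrite -[RHS]mulNmx opprB.
by rewrite -!mulmxA projEE projZZ.
Qed.

Lemma split_partD mu nu : split_part (mu + nu) = split_part mu + split_part nu.
Proof.
apply: eq_law => x y; rewrite bracket_lawD !bracket_split_part !bracket_lawD.
by rewrite -mulmxDl opprD addrACA.
Qed.

Lemma split_part_scale c mu : split_part (c *: mu) = c *: split_part mu.
Proof.
apply: eq_law => x y; rewrite bracket_lawZ !bracket_split_part !bracket_lawZ.
by rewrite -scalerBr scalemxAl.
Qed.

Lemma split_part_id w : split_law w -> split_part w = 2%:R *: w.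
Proof.
move=> wW; apply: eq_law => x y; rewrite bracket_split_part bracket_lawZ.
rewrite (wW.1 (y *m _)) opprK mulmxDl -wW.2.
by rewrite scalerDl scale1r.
Qed.

(** The right-hand side is the derivative at [c = 0] of [twist w (1 + cA) (1 + cB)]: the tangent
    space of the orbit at [w] is the whole space of split laws. *)
Definition tangent_onto w := forall w', split_law w' ->
  exists A B, [/\ blockE A, blockZ B & forall x y, bracket w' x y =
    bracket w (x *m A) y + bracket w x (y *m A) + bracket w x y *m B].

End SplitLaws.

(** * Density of the orbit among the split laws *)

Section Dominance.

Variables (K : closedFieldType) (n : nat) (z : pred 'I_n).
Hypothesis two_neq0 : 2%:R != 0 :> K.
Variable g : law K n.
Hypotheses (g_split : split_law z g) (g_onto : tangent_onto z g).

(** The polynomial takes the value 1 at 0. Hence [1 + cA] is invertible for all but finitely many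
    [c]. *)
Lemma det_line_neq0 (A : 'M[K]_n) :
  exists2 q : {poly K}, q != 0 & forall c, q.[c] = \det (1%:M + c *: A).
Proof.
pose M : 'M[{poly K}]_n := 1%:M + 'X *: map_mx polyC A.
have detM c : (\det M).[c] = \det (1%:M + c *: A).
  rewrite -[LHS]/(horner_eval c (\det M)) -det_map_mx; congr (\det _).
  apply/matrixP => i j; rewrite !mxE /= rmorphD rmorphM rmorph_nat /=.
  by rewrite /horner_eval hornerX hornerC.
exists (\det M) => //; apply/eqP => M0; have := detM 0.
by rewrite M0 scale0r addr0 horner0 det1 => /eqP; rewrite eq_sym oner_eq0.
Qed.

(** The twist is cubic in [c], one degree for each argument and one for the value. The coefficients
    [w2] and [w3] do not depend on [c]. *)
Lemma twist_line (A B : 'M[K]_n) : exists w2 w3, forall w1 : law K n,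
  (forall x y, bracket w1 x y =
     bracket g (x *m A) y + bracket g x (y *m A) + bracket g x y *m B) ->
  forall c : K, twist g (1%:M + c *: A) (1%:M + c *: B) =
    g + c *: w1 + c ^+ 2 *: w2 + c ^+ 3 *: w3.
Proof.
(* Polarization: the three twists by [B] leave [([xA, y] + [x, yA])B], the mixed term of order 2. *)
pose w2 := twist g A 1%:M + (twist g (1%:M + A) B + (-1) *: (twist g 1%:M B + twist g A B)).
exists w2, (twist g A B) => w1 w1E c; apply: eq_law => x y.
have w2E : bracket w2 x y = bracket g (x *m A) (y *m A)
    + (bracket g (x *m A) y + bracket g x (y *m A)) *m B.
  rewrite 2!bracket_lawD bracket_lawZ bracket_lawD !bracket_twist !mulmx1.
  rewrite !mulmxDr !mulmx1 !bracketDl !bracketDr.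
  move: (bracket g x y) (bracket g (x *m A) y) (bracket g x (y *m A))
        (bracket g (x *m A) (y *m A)) => b00 b10 b01 b11.
  rewrite !mulmxDl; move: (b00 *m B) (b10 *m B) (b01 *m B) (b11 *m B).
  by move=> d00 d10 d01 d11; apply/rowP => k; rewrite !mxE; ring.
rewrite 3!bracket_lawD 3!bracket_lawZ 2!bracket_twist w1E w2E.
rewrite !(mulmxDr _ 1%:M) !mulmx1 -!scalemxAr !bracketDl !bracketDr.
rewrite !bracketZl !bracketZr.
move: (bracket g x y) (bracket g (x *m A) y) (bracket g x (y *m A))
      (bracket g (x *m A) (y *m A)) => b00 b10 b01 b11.
rewrite ?(mulmxDl, =^~ scalemxAl).
move: (b00 *m B) (b10 *m B) (b01 *m B) (b11 *m B) => d00 d10 d01 d11.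
by apply/rowP => k; rewrite !mxE; ring.
Qed.

(* Along tau(c) = half (twist g (1 + c A) (1 + c B)) + c (t - half (split_part t)),
   the first order term at c = 0 is t when (A, B) is chosen by [g_onto]. *)
Lemma orbit_dominant (p : {mpoly K[n * n * n]}) : p != 0 ->
  exists A B, exists2 tau : law K n, p.@[mxvec tau 0] != 0 &
    [/\ blockE z A, blockZ z B, 1%:M + A \in unitmx, 1%:M + B \in unitmx
      & split_part z tau = twist g (1%:M + A) (1%:M + B)].
Proof.
move=> p_neq0; have [h h2] : exists h : K, h * 2%:R = 1 by exists 2%:R^-1; rewrite mulVf.
pose half (w : law K n) := h *: w.
have half_part w : split_law z w -> split_part z (half w) = w.
  by move=> wW; rewrite split_part_scale split_part_id // scalerA h2 scale1r.
pose v0 := mxvec (half g).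
(* [p] is recentred at [half g], the point of the curve at [c = 0]. *)
have [q qE] : polyfun (fun v : 'rV[K]_(n * n * n) => p.@[(v0 + v) 0]).
  apply: polyfun_meval => i.
  exact: polymxD (polymx_const _ v0) (@polymx_id K _) 0 i.
have q_neq0 : q != 0.
  have [v1 v1P] := mpoly_neq0_nonroot p_neq0; apply: contra v1P => /eqP q0.
  by have := qE (v1 - v0); rewrite q0 meval0 addrC subrK => ->.
have [t tP] := mpoly_curve q_neq0; pose s : law K n := vec_mx t.
have [A [B [EA ZB sE]]] := g_onto (split_part_split z s).
have [w2 [w3 /(_ _ sE) wE]] := twist_line A B.
(* With this [u], the curve [half g + X u] is [tau]: the first order terms add up to [s], and those
   of higher order come from the twist. *)
pose u i : {poly K} := (mxvec s 0 i)%:P + 'X * (mxvec (half w2) 0 i)%:P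
                       + 'X ^+ 2 * (mxvec (half w3) 0 i)%:P.
have u0 i : (u i).[0] = t 0 i.
  by rewrite /u !hornerE ?expr0n /= ?mul0r ?addr0 vec_mxK.
have [dA dA_neq0 dAE] := det_line_neq0 A.
have [dB dB_neq0 dBE] := det_line_neq0 B.
(* A value of [c] outside the roots of the three polynomials keeps [p] nonzero and both block
   matrices invertible. *)
have := mulf_neq0 (mulf_neq0 (tP u u0) dA_neq0) dB_neq0.
case/closed_nonrootP => c; rewrite rootE !hornerM !mulf_eq0 !negb_or dAE dBE.
rewrite horner_mmap => /andP[/andP[pc detA] detB].
have EcA : blockE z (c *: A) by rewrite /blockE -scalemxAr -scalemxAl EA.
have ZcB : blockZ z (c *: B) by rewrite /blockZ -scalemxAr -scalemxAl ZB.
pose w := twist g (1%:M + c *: A) (1%:M + c *: B).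
pose tau := half w + c *: (s - half (split_part z s)).
exists (c *: A), (c *: B), tau; last first.
  split; rewrite // ?unitmxE ?unitfE //.
  (* The correction added to [half w] lies in the kernel of [split_part]: it lets [tau] move in
     every ambient direction while its split part stays in the orbit. *)
  rewrite split_partD half_part; last exact: split_law_twist.
  rewrite split_part_scale split_partD -[- half _]scaleN1r split_part_scale.
  rewrite half_part; last exact: split_part_split.
  by rewrite scaleN1r subrr scaler0 addr0.
have -> : p.@[mxvec tau 0] = q.@[fun i => ('X * u i).[c]]; last by [].
pose v : 'rV[K]_(n * n * n) := \row_i ('X * u i).[c].
rewrite [RHS](@meval_eq _ _ _ (v 0)); last by move=> i; rewrite mxE.
rewrite -qE; apply: meval_eq => i.
have coD (a b : law K n) : mxvec (a + b) 0 i = mxvec a 0 i + mxvec b 0 i.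
  by rewrite linearD mxE.
have coZ k (a : law K n) : mxvec (k *: a) 0 i = k * mxvec a 0 i.
  by rewrite linearZ mxE.
have coN (a : law K n) : mxvec (- a) 0 i = - mxvec a 0 i.
  by rewrite linearN mxE.
have -> : (v0 + v) 0 i = mxvec (half g) 0 i + c * (mxvec s 0 i
    + c * mxvec (half w2) 0 i + c ^+ 2 * mxvec (half w3) 0 i).
  by rewrite !mxE /u !hornerE.
rewrite /tau /half /w wE.
rewrite !(coD, coN, coZ).
move: (mxvec s 0 i) (mxvec g 0 i) (mxvec (split_part z s) 0 i)
  (mxvec w2 0 i) (mxvec w3 0 i) => a0 a1 a2 a3 a4.
by ring.
Qed.

End Dominance.

(** * The open orbit *)

Section OpenOrbit.

Variables (K : closedFieldType) (n : nat) (z : pred 'I_n).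
Hypothesis two_neq0 : 2%:R != 0 :> K.
Variable g : law K n.
Hypotheses (g_split : split_law z g) (g_onto : tangent_onto z g).

Lemma polymx_split_part N (mu : 'rV[K]_N -> law K n) :
  polymx mu -> polymx (fun v => split_part z (mu v)).
Proof.
move=> pmu; apply: polymx_law_of => x y; apply: polymxM; last exact: polymx_const.
by apply: polymxD; last apply: polymxN; apply: polymx_bracket => //;
  apply: polymx_const.
Qed.

(** Membership in the orbit is the solvability in [(f, f')] of the equations [f f' = 1] and
    [split_part t = twist g f f']. It is therefore generically constant, and [orbit_dominant] rules
    out that it is generically false. *)
Lemma generic_in_orbit : exists2 p : {mpoly K[n * n * n]}, p != 0 &
  forall t : law K n, p.@[mxvec t 0] != 0 -> law_orbit g (split_part z t).
Proof.
pose M := (n * n + n * n)%N.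
pose dom (v : 'rV[K]_(n * n * n + M)) : law K n := vec_mx (lsubmx v).
pose f (v : 'rV[K]_(n * n * n + M)) : 'M[K]_n := vec_mx (lsubmx (rsubmx v)).
pose f' (v : 'rV[K]_(n * n * n + M)) : 'M[K]_n := vec_mx (rsubmx (rsubmx v)).
pose phi v := row_mx (mxvec (f v *m f' v - 1%:M))
                     (mxvec (split_part z (dom v) - twist g (f v) (f' v))).
have pdom : polymx dom by apply/polymx_vec_mx/polymx_lsubmx/polymx_id.
have pf : polymx f by apply/polymx_vec_mx/polymx_lsubmx/polymx_rsubmx/polymx_id.
have pf' : polymx f' by apply/polymx_vec_mx/polymx_rsubmx/polymx_rsubmx/polymx_id.
have pphi : polymx phi.
  move=> i j; rewrite -(splitK j); case: (split j) => k /=.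
    apply: eq_polyfun (fun v => esym (row_mxEl _ _ i k)) _.
    apply: polymx_mxvec; apply: polymxD; first exact: polymxM.
    exact: polymx_const.
  apply: eq_polyfun (fun v => esym (row_mxEr _ _ i k)) _.
  apply: polymx_mxvec; apply: polymxD; first exact: polymx_split_part.
  by apply/polymxN/polymx_twist => //; apply: polymx_const.
have [p p_neq0 [b bP]] := generic_projection_mx pphi.
exists p => // t pt; have := bP _ pt.
have in_orbit u : law_orbit g (split_part z u) <->
    exists w : 'rV[K]_M, phi (row_mx (mxvec u) w) = 0.
  split=> [[h uh eq_u]|[w]].
    exists (row_mx (mxvec h) (mxvec (invmx h))).
    rewrite /phi /f /f' /dom row_mxKl !row_mxKr row_mxKl !mxvecK.
    by rewrite mulmxV // eq_u !subrr !linear0 row_mx0.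
  rewrite /phi -row_mx0 => /eq_row_mx[].
  rewrite /dom row_mxKl mxvecK; set h := f _; set h' := f' _.
  move/(congr1 vec_mx); rewrite mxvecK linear0 => /eqP; rewrite subr_eq0 => /eqP hh'.
  move/(congr1 vec_mx); rewrite mxvecK linear0 => /eqP; rewrite subr_eq0 => /eqP ->.
  have [uh _] := mulmx1_unit hh'; exists h => //.
  rewrite /act -/(twist g h (invmx h)); congr twist.
  by rewrite -[h']mul1mx -(mulVmx uh) -mulmxA hh' mulmx1.
case: b bP => bP [_ bt]; first exact/in_orbit/bt.
have [A [B [tau ptau [EA ZB uA uB tauE]]]] :=
  orbit_dominant two_neq0 g_split g_onto p_neq0.
have [] : exists w : 'rV[K]_M, phi (row_mx (mxvec tau) w) = 0.
  by apply/in_orbit; rewrite tauE; apply: (law_orbit_twist g_split).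
by move=> w wP; have [/(_ (ex_intro _ w wP))] := bP _ ptau.
Qed.

(** A polynomial vanishing on the orbit, composed with [split_part], vanishes off a hypersurface and
    so identically. Its value at [w / 2] is the value of the original polynomial at [w]. *)
Lemma split_law_closure w : split_law z w -> Zariski_closure (law_orbit g) w.
Proof.
move=> wW C [S CS] orbitC; apply/CS => q Sq.
have [p p_neq0 pP] := generic_in_orbit.
have [q' q'E] : polyfun (fun v : 'rV[K]_(n * n * n) =>
    q.@[mxvec (split_part z (vec_mx v)) 0]).
  apply: polyfun_meval => i; apply: polymx_mxvec; apply: polymx_split_part.
  exact/polymx_vec_mx/polymx_id.
have q'0 : q' = 0.
  apply/eqP; apply: contraT => /(mulf_neq0 p_neq0)/mpoly_neq0_nonroot[v].
  rewrite mevalM mulf_eq0 negb_or => /andP[pv /negP[]].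
  rewrite -q'E; apply/eqP; apply: (CS _).1 => //; apply: orbitC.
  by apply: pP; rewrite vec_mxK.
have := q'E (mxvec (2%:R^-1 *: w)); rewrite q'0 meval0 mxvecK.
by rewrite split_part_scale split_part_id // scalerA mulVf // scale1r.
Qed.

End OpenOrbit.

(** One neighbourhood of [g] is enough: the translates of the locus where [R] is nonzero form an
    open set, and the group action carries the inclusion in the orbit from one translate to all. *)
Lemma rigid_local (K : fieldType) n (g : law K n) (R : 'rV[K]_(n * n * n) -> K) :
    two_nilp g -> polyfun R -> R (mxvec g) != 0 ->
    (forall mu, two_nilp mu -> R (mxvec mu) != 0 -> law_orbit g mu) ->
  rigid g.
Proof.
move=> g_nilp polyR Rg RP; split=> //.
exists (fun mu => exists2 f, f \in unitmx & R (mxvec (act f mu)) != 0); last first.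
  move=> mu; split=> [orb | [[f uf Rf] mu_nilp]].
    split; last exact: two_nilp_orbit orb g_nilp.
    by have /law_orbit_sym[f uf eq_g] := orb; exists f; rewrite -?eq_g.
  apply: law_orbit_trans (law_orbit_sym _); last by exists f.
  by apply: RP => //; apply: two_nilp_orbit mu_nilp; exists f.
(* The complement is cut out by one translate of [R] for each invertible [f]; since [f] is fixed in
   each equation, [invmx f] is a constant matrix there. *)
exists (fun p => exists2 f, f \in unitmx &
  forall mu : law K n, p.@[mxvec mu 0] = R (mxvec (act f mu))).
move=> mu; split=> [notW p [f uf pE]|vanish [f uf]].
  by rewrite pE; apply/eqP; apply: contraT => Rf; case: notW; exists f.
have [q qE] := polyR.
have [p pE] : polyfun (fun v : 'rV[K]_(n * n * n) => q.@[mxvec (act f (vec_mx v)) 0]).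
  apply: polyfun_meval => i; apply: polymx_mxvec.
  by apply: polymx_twist; try exact: polymx_const; apply/polymx_vec_mx/polymx_id.
rewrite qE -[mu]mxvecK pE vanish ?eqxx //.
by exists f => // nu; rewrite -pE mxvecK qE.
Qed.

(** * Dimension 2p + 1 *)

Section OddDimension.

Variables (K : closedFieldType) (p : nat).
Hypotheses (two_neq0 : 2%:R != 0 :> K) (p_gt0 : (0 < p)%N).
Let n := p.*2.+1.
Implicit Types (mu w : law K n) (f : 'M[K]_n).

(* X_3, X_5, ..., X_(2p+1), numbered from 0. *)
Definition central : pred 'I_n := fun i => (0 < i)%N && ~~ odd i.

(** The index of the vector whose bracket with the first basis vector is meant to give the central
    vector [i]. *)
Definition partner (i : 'I_n) : 'I_n := inord i.-1.

Lemma partnerE (i : 'I_n) : partner i = i.-1 :> nat.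
Proof. by rewrite inordK // (leq_ltn_trans (leq_pred _)). Qed.

Lemma central_partner i : central i -> ~~ central (partner i).
Proof.
by case: i => [[|i] lti] //; rewrite /central partnerE /= => /negbNE ->; rewrite andbF.
Qed.

Lemma odd_partner (j : 'I_n) : ~~ central j -> j != 0 ->
  exists2 k, central k & partner k = j.
Proof.
move=> jE j_neq; have j_odd : odd j.
  by move: jE; rewrite /central lt0n j_neq negbK.
have jS : (j.+1 < n)%N.
  rewrite ltn_neqAle ltn_ord andbT; apply: contraTneq j_odd => -[->].
  by rewrite odd_double.
exists (Ordinal jS); first by rewrite /central /= j_odd.
by apply/ord_inj; rewrite partnerE.
Qed.

Definition adapted mu f := forall i : 'I_n, central i ->
  row i f = bracket mu (row 0 f) (row (partner i) f).

(** An adapted family depending polynomially on [mu]. At a law with the normalized brackets of [g]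
    it is the identity, so it remains a basis in a neighbourhood. *)
Definition frame mu : 'M[K]_n := \matrix_i
  (if central i then bracket mu (delta_mx 0 0) (delta_mx 0 (partner i))
   else delta_mx 0 i).

Lemma row_frame mu i : row i (frame mu) =
  if central i then bracket mu (delta_mx 0 0) (delta_mx 0 (partner i)) else delta_mx 0 i.
Proof. exact: rowK. Qed.

Lemma frame_adapted mu : adapted mu (frame mu).
Proof.
by move=> i iZ; rewrite !row_frame iZ (negPf (central_partner iZ)).
Qed.

Lemma skew_diag w x : skew_symmetric w -> bracket w x x = 0.
Proof.
move=> sw; have /eqP := sw x x; rewrite -subr_eq0 opprK -mulr2n -scaler_nat.
by rewrite scaler_eq0 (negPf two_neq0) => /eqP.
Qed.

Lemma sum_odd_index (V : nmodType) (F : nat -> V) :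
  \sum_(i < n) F i = F 0%N + (\sum_(k < p) F k.*2.+1 + \sum_(k < p) F k.*2.+2).
Proof.
rewrite {}/n; elim: p => [|m IHm]; first by rewrite big_ord1 !big_ord0 !addr0.
rewrite doubleS !(big_ord_recr m.*2.+2) !(big_ord_recr m.*2.+1) /= IHm.
by rewrite !(big_ord_recr m) /= -!addrA; do 2!congr (_ + _); rewrite addrCA.
Qed.

(** In the new basis the central vectors are brackets, hence annihilated by the law. Conversely
    every bracket [u] is annihilated: bracketing it with the first vector kills its coordinates at
    the partners, then bracketing with a partner kills its first coordinate, so [u] is in the
    central span. *)
Lemma adapted_split mu f : two_nilp mu -> f \in unitmx -> adapted mu f ->
  split_law central (act f mu).
Proof.
move=> mu_nilp uf fP; set w := act f mu.
have [sw w_nilp] : two_nilp w by apply: two_nilp_orbit mu_nilp; exists f.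
have wpartner i : central i -> bracket w (delta_mx 0 0) (delta_mx 0 (partner i)) = delta_mx 0 i.
  by move=> iZ; rewrite bracket_act -!rowE -fP // rowE mulmxK.
have wZ i y : central i -> bracket w (delta_mx 0 i) y = 0.
  by move=> iZ; rewrite -(wpartner i iZ) w_nilp.
have xE (x : 'rV[K]_n) : x = x *m projE K central + x *m projZ K central.
  by rewrite -mulmxDr projED mulmx1.
have wprojZ x y : bracket w (x *m projZ K central) y = 0.
  rewrite [x *m _]row_sum_delta bracket_suml big1 // => i _; rewrite bracketZl.
  rewrite mulmx_projE; case: (boolP (central i)) => [/wZ->|_].
    by rewrite scaler0.
  by rewrite mulr0 scale0r.
have wprojE x y : bracket w x y = bracket w (x *m projE K central) y.
  by rewrite {1}[x]xE bracketDl wprojZ addr0.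
have wprojEE x y : bracket w x y =
    bracket w (x *m projE K central) (y *m projE K central).
  by rewrite wprojE sw wprojE sw opprK.
split=> // x y; rewrite -wprojEE; have := w_nilp x y.
move: (bracket w x y) => u uC.
suff uE : u *m projE K central = 0 by rewrite {1}[u]xE uE add0r.
have vC t : bracket w t (u *m projE K central) = 0 by rewrite sw -wprojE uC oppr0.
have upartner k : central k -> u 0 (partner k) = 0.
  move=> kZ; have /rowP/(_ k) := vC (delta_mx 0 0).
  rewrite [u *m _]row_sum_delta bracket_sumr summxE (bigD1 (partner k)) //=.
  rewrite bracketZr mxE wpartner // mulmx_projE /= central_partner // mulr1.
  rewrite [in RHS]mxE [delta_mx _ _ _ _]mxE !eqxx mulr1 big1 ?addr0 // => j j_neq.
  rewrite bracketZr mxE mulmx_projE /=.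
  have [jZ|jE] := boolP (central j); first by rewrite mulr0 mul0r.
  case: (eqVneq j 0) => [->|/(odd_partner jE)[l lZ lj]].
    by rewrite skew_diag // mxE mulr0.
  rewrite -{2}lj wpartner // mxE eqxx /=; case: eqP => [kl|]; last by rewrite mulr0.
  by case/eqP: j_neq; rewrite -lj kl.
(* As [p] is positive there is a central index 2, whose partner detects the one coordinate still to
   be killed. *)
have n_gt2 : (2 < n)%N by rewrite /n; case: (p) p_gt0 => // m _; rewrite doubleS.
have two_central : central (Ordinal n_gt2) by [].
have vE : u *m projE K central = u 0 0 *: delta_mx 0 0.
  apply/rowP => j; rewrite mulmx_projE !mxE eqxx /=.
  case: (eqVneq j 0) => [->|j_neq]; first by rewrite mulr1.
  have [jZ|jE] := boolP (central j); first by rewrite !mulr0.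
  by have [l lZ <-] := odd_partner jE j_neq; rewrite upartner // mul0r mulr0.
have := vC (delta_mx 0 (partner (Ordinal n_gt2))).
rewrite vE bracketZr sw wpartner // scalerN => /rowP/(_ (Ordinal n_gt2)).
by rewrite !mxE !eqxx mulr1 => /eqP; rewrite oppr_eq0 => /eqP->; rewrite scale0r.
Qed.

Variable g : law K n.
Hypotheses (g_split : split_law central g) (g_onto : tangent_onto central g).
Hypothesis g_adapted : forall i, central i ->
  bracket g (delta_mx 0 0) (delta_mx 0 (partner i)) = delta_mx 0 i.

Lemma split_law_rigid : rigid g.
Proof.
have [q q_neq0 qP] := generic_in_orbit two_neq0 g_split g_onto.
have [A [B [tau qtau [EA ZB uA uB tauE]]]] :=
  orbit_dominant two_neq0 g_split g_onto q_neq0.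
(* The hypersurface [q = 0] might contain the point attached to [g]. Twisting by [A] and [B] moves
   [g] to the split part of [tau], and adding [r], the part of [tau] killed by [split_part], makes
   the point tested at [g] equal to [tau]. *)
pose half := 2%:R^-1 : K; pose r := tau - half *: split_part central tau.
pose theta mu := twist (twist mu (frame mu) (\adj (frame mu))) (1%:M + A) (1%:M + B).
pose R (v : 'rV[K]_(n * n * n)) := \det (frame (vec_mx v)) *
  q.@[mxvec (half *: theta (vec_mx v) + r) 0].
apply: (@rigid_local K n g R); first exact: split_law_two_nilp g_split.
- have plaw : polymx (fun v : 'rV[K]_(n * n * n) => vec_mx v : law K n).
    exact/polymx_vec_mx/polymx_id.
  have pframe : polymx (fun v : 'rV[K]_(n * n * n) => frame (vec_mx v)).
    move=> i j; case: (boolP (central i)) => iZ.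
      apply: eq_polyfun (polymx_bracket plaw (polymx_const _ (delta_mx 0 0))
        (polymx_const _ (delta_mx 0 (partner i))) 0 j) => v.
      by rewrite [RHS]mxE iZ.
    apply: eq_polyfun (polyfun_const _ ((delta_mx 0 i : 'rV[K]_n) 0 j)) => v.
    by rewrite [RHS]mxE (negPf iZ).
  apply: polyfunM; first exact: polyfun_det.
  apply: polyfun_meval => i; apply: polymx_mxvec.
  apply: polymxD; last exact: polymx_const.
  have ptheta : polymx (fun v : 'rV[K]_(n * n * n) => theta (vec_mx v)).
    apply: polymx_twist; try exact: polymx_const.
    by apply: polymx_twist => //; apply: polymx_adj.
  move=> k l; apply: eq_polyfun (polyfunM (polyfun_const _ half) (ptheta k l)) => v.
  by rewrite [RHS]mxE.
- rewrite /R mxvecK /theta.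
  have frame1 : frame g = 1%:M.
    by apply/row_matrixP => i; rewrite row_frame row1; case: ifP => // /g_adapted.
  have adj1 : \adj (1%:M : 'M[K]_n) = 1%:M.
    by rewrite -[LHS]mul1mx mul_mx_adj det1.
  have -> : twist g (frame g) (\adj (frame g)) = g.
    by apply: eq_law => x y; rewrite bracket_twist frame1 adj1 !mulmx1.
  by rewrite -tauE /r addrC subrK frame1 det1 mul1r.
move=> mu mu_nilp; rewrite /R mxvecK mulf_eq0 negb_or => /andP[d_neq0 qmu].
have uf : frame mu \in unitmx by rewrite unitmxE unitfE.
have w_split := adapted_split mu_nilp uf (@frame_adapted mu).
have theta_split : split_law central (\det (frame mu) *: act (frame mu) mu).
  exact: split_law_scale.
(* The adjugate in place of the inverse costs only a factor [\det (frame mu)], and scaling by a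
   nonzero factor stays in the orbit. *)
have twistE : twist mu (frame mu) (\adj (frame mu)) =
              \det (frame mu) *: act (frame mu) mu.
  apply: eq_law => x y; rewrite bracket_twist bracket_lawZ bracket_act.
  by rewrite scalemxAr /invmx uf scalerA mulfV // scale1r.
have orb_theta : law_orbit mu (theta mu).
  rewrite /theta twistE; apply: law_orbit_trans (law_orbit_twist theta_split _ _ _ _) => //.
  by apply: law_orbit_trans (law_orbit_scale _ d_neq0); exists (frame mu).
apply: law_orbit_trans (law_orbit_sym orb_theta).
have := qP _ qmu; rewrite split_partD split_part_scale split_part_id; last first.
  by rewrite /theta twistE; apply: split_law_twist.
rewrite scalerA mulVf // scale1r /r split_partD -[- (half *: _)]scaleN1r.
rewrite !split_part_scale (split_part_id (split_part_split _ tau)).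
by rewrite [half *: _]scalerA mulVf // scale1r scaleN1r subrr addr0.
Qed.

End OddDimension.

(** Each of the [p] Jordan blocks of size 2 contributes at least 1 to the rank. *)
Lemma rank_Jordan (K : fieldType) p n (A : 'M[K]_n) :
  Jordan_type A (rcons (nseq p 2%N) 1%N) -> (p <= \rank A)%N.
Proof.
set s := rcons _ _ => -[_ _ [P /andP[Pfree Pfull] PA]].
have <- : \rank (P *m A) = \rank A by rewrite (eqmxMfull _ Pfull).
rewrite PA mxrankMfree // rank_mxdiag.
have le2 i : ((nth 0%N s i == 2%N) <= \rank (Jordan_block K (nth 0%N s i)))%N.
  case: eqP => // ->; rewrite lt0n mxrank_eq0; apply/eqP => /matrixP.
  by move/(_ ord0 ord_max); rewrite !mxE => /eqP; rewrite oner_eq0.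
apply: (@leq_trans (\sum_(i < size s) (nth 0%N s i == 2%N))%N); last first.
  by apply: leq_sum => i _.
rewrite -(big_mkord xpredT (fun i => nat_of_bool (nth 0%N s i == 2%N))).
rewrite -(big_nth 0%N xpredT (fun m => nat_of_bool (m == 2%N))).
by rewrite -big_mkcond sum1_count /s -cats1 count_cat count_nseq mul1n leq_addr.
Qed.

(** * Adapted bases obtained from the characteristic sequence *)

Section Family.

Variables (K : closedFieldType) (p : nat).
Hypotheses (two_neq0 : 2%:R != 0 :> K) (p_gt0 : (0 < p)%N).
Let n := p.*2.+1.

(** The basis is made of [x], vectors [y k] with independent brackets [[x, y k]], and these
    brackets. A linear relation is undone in stages: bracketing with [x] isolates the coefficients
    of the [y k], bracketing with [y 0] that of [x], and only the independent brackets remain. *)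
Lemma adapted_basis (mu : law K n) x : two_nilp mu -> (p <= \rank (ad mu x))%N ->
  exists2 f, f \in unitmx & adapted mu f.
Proof.
move=> [sw nilp] le_p.
(* The [y k] are basis vectors indexing [p] independent rows of [ad mu x]; beyond [p] the value is a
   default. *)
pose y k : 'rV[K]_n := if insub k is Some i
  then delta_mx 0 (maxrankfun (ad mu x) (widen_ord le_p i)) else 0.
have row_ad i : row i (ad mu x) = bracket mu x (delta_mx 0 i).
  by apply/rowP => j; rewrite !mxE.
have indep (c : nat -> K) : \sum_(k < p) c k *: bracket mu x (y k) = 0 ->
    forall k, (k < p)%N -> c k = 0.
  move=> sum0 k ltkp; pose M := rowsub (maxrankfun (ad mu x)) (ad mu x).
  pose v : 'rV[K]_(\rank (ad mu x)) := \row_j (if (j < p)%N then c j else 0).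
  have /eqP : v *m M = 0.
    rewrite mulmx_sum_row -[RHS]sum0.
    rewrite (big_ord_widen _ (fun k => c k *: bracket mu x (y k)) le_p) [RHS]big_mkcond /=.
    apply: eq_bigr => j _; rewrite mxE; case: ifP => [ltjp|]; last by rewrite scale0r.
    rewrite row_rowsub row_ad /y insubT; congr (_ *: bracket _ _ (delta_mx _ (maxrankfun _ _))).
    exact: ord_inj.
  rewrite mulmx_free_eq0 ?maxrowsub_free // => /eqP/rowP/(_ (widen_ord le_p (Ordinal ltkp))).
  by rewrite !mxE /= ltkp.
(* Interleaved order [x, y 0, [x, y 0], y 1, [x, y 1], ...], which puts each bracket right after its
   partner. *)
pose r k := if k is 0 then x else if odd k then y k./2 else bracket mu x (y k.-2./2).
exists (\matrix_(i < n) r i); last first.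
  move=> i; rewrite /central => /andP[i_gt0 i_even]; rewrite !rowK partnerE /=.
  case: (nat_of_ord i) i_gt0 i_even => // -[|k] //= _; rewrite negbK => k_even.
  by rewrite /r /= k_even uphalf_half (negPf k_even).
rewrite -row_free_unit; apply: inj_row_free => v vf.
pose c k := v 0 (inord k).
have r_odd k : r k.*2.+1 = y k by rewrite /r /= odd_double /= uphalf_double.
have r_even k : r k.*2.+2 = bracket mu x (y k).
  by rewrite /r /= odd_double /= doubleK.
have {vf} sum0 : c 0%N *: x + (\sum_(k < p) c k.*2.+1 *: y k
    + \sum_(k < p) c k.*2.+2 *: bracket mu x (y k)) = 0.
  rewrite -[RHS]vf mulmx_sum_row -[x in LHS]/(r 0%N).
  under eq_bigr do rewrite -r_odd.
  under [X in _ + (_ + X)]eq_bigr do rewrite -r_even.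
  rewrite -(sum_odd_index p (fun k => c k *: r k)).
  by apply: eq_bigr => i _; rewrite rowK /c inord_val.
have c_odd k : (k < p)%N -> c k.*2.+1 = 0.
  apply: (indep (fun k => c k.*2.+1)).
  have /(congr1 (bracket mu x)) := sum0; rewrite bracket0r => eq0; rewrite -[RHS]eq0.
  rewrite !bracketDr bracketZr (skew_diag two_neq0) // scaler0 add0r !bracket_sumr.
  rewrite [X in _ + X]big1 ?addr0 => [|j _]; last first.
    by rewrite bracketZr sw nilp oppr0 scaler0.
  by apply: eq_bigr => j _; rewrite bracketZr.
have {}sum0 : c 0%N *: x + \sum_(k < p) c k.*2.+2 *: bracket mu x (y k) = 0.
  rewrite -[RHS]sum0 [X in _ + (X + _)]big1 ?add0r // => k _.
  by rewrite c_odd // scale0r.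
have c0 : c 0%N = 0.
  have /(congr1 (bracket mu ^~ (y 0%N))) := sum0.
  rewrite bracketDl bracketZl bracket_suml big1 ?bracket0l ?addr0 => [|k _].
    move=> eq0; apply: (indep (fun k => if k is 0 then c 0%N else 0) _ 0%N p_gt0).
    case: (p) p_gt0 => // m _; rewrite big_ord_recl eq0 add0r big1 // => k _.
    by rewrite scale0r.
  by rewrite bracketZl nilp scaler0.
have c_even k : (k < p)%N -> c k.*2.+2 = 0.
  apply: (indep (fun k => c k.*2.+2)).
  by rewrite -[RHS]sum0 c0 scale0r add0r.
have cP k : (k < n)%N -> c k = 0.
  rewrite -(odd_double_half k); move: k./2 (odd k) => h [].
    by rewrite add1n ltnS ltn_double; apply: c_odd.
  rewrite add0n ltnS leq_double; case: h => // h; exact: c_even.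
by apply/rowP => i; rewrite mxE -[i]inord_val; apply: cP.
Qed.

Variable g : law K n.
Hypotheses (g_split : split_law (@central p) g).
Hypothesis g_onto : tangent_onto (@central p) g.

(** A vector realizing the characteristic sequence gives an adapted basis; in it the law is split,
    hence in the closure of the orbit of [g]. *)
Lemma familyF_contraction (mu : law K n) :
    two_nilp mu -> char_sequence mu (rcons (nseq p 2%N) 1%N) ->
  exists2 nu, contraction g nu & law_orbit nu mu.
Proof.
move=> mu_nilp [[x _ /rank_Jordan le_p] _].
have [f uf fP] := adapted_basis mu_nilp le_p.
have split_nu := adapted_split two_neq0 p_gt0 mu_nilp uf fP.
exists (act f mu); last by apply: law_orbit_sym; exists f.
split; first exact: two_nilp_Lie (split_law_two_nilp split_nu).
exact: (split_law_closure two_neq0 g_split g_onto).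
Qed.

End Family.

(** * Certificates *)

Section BasisLaws.

Variables (p : nat) (b : seq (nat * nat * nat)).
Let n := p.*2.+1.

Definition pos_even (i : nat) : bool := (0 < i)%N && ~~ odd i.

(** Structure constants as integers, so that the checks are closed computations independent of the
    field. *)
Definition coef (i j k : nat) : int :=
  Posz ((i.+1, j.+1, k.+1) \in b) - Posz ((j.+1, i.+1, k.+1) \in b).

Definition split_check : bool :=
  all (fun t => [&& ~~ pos_even t.1.1.-1, ~~ pos_even t.1.2.-1 & pos_even t.2.-1]) b.

Definition adapted_check : bool :=
  all (fun i => all (fun k => coef 0 i.-1 k == Posz (i == k)) (iota 0 n))
    (filter pos_even (iota 0 n)).

(* Matrix entries (row, column, value), numbered from 0. *)
Definition entry : Type := (nat * nat * int)%type.
Definition certificate := seq (nat * nat * nat * (seq entry * seq entry)).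

Definition entry_at (s : seq entry) i j : int :=
  foldr (fun e x => if (e.1.1 == i) && (e.1.2 == j) then e.2 else x) 0 s.

Definition cert_at (cert : certificate) (i j k : nat) :=
  foldr (fun e x => if e.1 == (i, j, k) then e.2 else x) ([::], [::]) cert.

Definition sum_int (F : nat -> int) (s : seq nat) : int :=
  foldr (fun m x => F m + x) 0 s.

Let sE := filter (fun i => ~~ pos_even i) (iota 0 n).
Let sZ := filter pos_even (iota 0 n).

(** The elementary laws with a single nonzero bracket, up to skew-symmetry, span the split laws. For
    each of them the certificate must give a preimage of [d] times that law under the tangent map;
    the factor [d] clears denominators. *)
Definition tangent_check (d : int) (cert : certificate) : bool :=
  all (fun i => all (fun j => (i < j)%N ==> all (fun k =>
    let: (u, v) := cert_at cert i j k in
    all (fun x => all (fun y => all (fun t =>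
      sum_int (fun m => entry_at u x m * coef m y t) sE
      + sum_int (fun m => entry_at u y m * coef x m t) sE
      + sum_int (fun m => entry_at v m t * coef x y m) sZ
      == d * (Posz ((i, j, k) == (x, y, t)) - Posz ((i, j, k) == (y, x, t))))
    sZ) sE) sE) sZ) sE) sE.

Variable K : closedFieldType.
Let g : law K n := basis_law K n b.

Lemma basis_lawE (i j k : 'I_n) : g (mxvec_index i j) k = (coef i j k)%:~R.
Proof.
rewrite /g /basis_law !mxE mxvecE !mxE /coef intrD rmorphN /=.
by [].
Qed.

Lemma row_basis_law (i j k : 'I_n) :
  row (mxvec_index i j) g 0 k = (coef i j k)%:~R.
Proof. by rewrite mxE basis_lawE. Qed.

Lemma bracket_basis_law (i j k : 'I_n) :
  bracket g (delta_mx 0 i) (delta_mx 0 j) 0 k = (coef i j k)%:~R.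
Proof. by rewrite bracket_delta row_basis_law. Qed.

Lemma coefN i j k : coef j i k = - coef i j k.
Proof. by rewrite /coef opprB. Qed.

Lemma coef_eq0 i j k : split_check -> [|| pos_even i, pos_even j | ~~ pos_even k] -> coef i j k = 0.
Proof.
move=> /allP chk nz; rewrite /coef.
have notin x y : [|| pos_even x, pos_even y | ~~ pos_even k] -> (x.+1, y.+1, k.+1) \in b = false.
  by move=> nzxy; apply: contraTF nzxy => /chk /=; case: (pos_even x) (pos_even y) (pos_even k) => [] [] [].
by rewrite !notin // orbCA.
Qed.

Lemma basis_law_split : split_check -> split_law (@central p) g.
Proof.
move=> chk.
have skew : skew_symmetric g.
  move=> x y; rewrite !bracketE -sumrN exchange_big; apply: eq_bigr => i _.
  rewrite -sumrN; apply: eq_bigr => j _; rewrite mulrC -scalerN; congr (_ *: _).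
  by apply/rowP => k; rewrite [RHS]mxE !row_basis_law coefN rmorphN.
split=> // x y; apply/rowP => k; rewrite mulmx_projE !bracketE !summxE mulr_suml.
apply: eq_bigr => i _; rewrite !summxE mulr_suml; apply: eq_bigr => j _.
rewrite [LHS]mxE [X in _ = X * _]mxE !mulmx_projE row_basis_law /=.
have [|] := boolP [|| pos_even i, pos_even j | ~~ pos_even k].
  by move/(coef_eq0 chk) => ->; rewrite !mulr0 mul0r.
rewrite !negb_or negbK => /and3P[iE jE kZ].
by rewrite /central -!/(pos_even _) iE jE kZ !mulr1.
Qed.

Lemma basis_law_adapted : adapted_check -> forall i, @central p i ->
  bracket g (delta_mx 0 0) (delta_mx 0 (partner i)) = delta_mx 0 i.
Proof.
move=> /allP chk i iZ; apply/rowP => k; rewrite bracket_basis_law partnerE.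
have /chk/allP/(_ k) : (i : nat) \in filter pos_even (iota 0 n).
  by rewrite mem_filter mem_iota /= add0n ltn_ord andbT.
rewrite mem_iota /= add0n ltn_ord => /(_ isT)/eqP->.
by rewrite mxE eqxx eq_sym.
Qed.

Lemma sum_intE (P : pred nat) F :
  (sum_int F (filter P (iota 0 n)))%:~R = \sum_(m < n | P m) (F m)%:~R :> K.
Proof.
rewrite -(big_mkord P (fun m => (F m)%:~R)) -big_filter /index_iota subn0.
by elim: (filter P _) => [|m s IHs]; rewrite ?big_nil ?big_cons //= intrD IHs.
Qed.

Lemma bracket_mulmxE (A : 'M[K]_n) (i j k : 'I_n) :
  bracket g (delta_mx 0 i *m A) (delta_mx 0 j) 0 k =
    \sum_(m < n) A i m * (coef m j k)%:~R.
Proof.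
rewrite -rowE [row i A]row_sum_delta bracket_suml summxE.
by apply: eq_bigr => m _; rewrite bracketZl mxE bracket_basis_law mxE.
Qed.

Lemma eq_bracket_linear (w : law K n) (A B : 'M[K]_n) :
    (forall i j, bracket w (delta_mx 0 i) (delta_mx 0 j) =
      bracket g (delta_mx 0 i *m A) (delta_mx 0 j)
      + bracket g (delta_mx 0 i) (delta_mx 0 j *m A)
      + bracket g (delta_mx 0 i) (delta_mx 0 j) *m B) ->
  forall x y, bracket w x y =
    bracket g (x *m A) y + bracket g x (y *m A) + bracket g x y *m B.
Proof.
move=> wE x y; rewrite [x]row_sum_delta mulmx_suml !bracket_suml mulmx_suml.
rewrite -!big_split /=; apply: eq_bigr => i _; rewrite -scalemxAl !bracketZl.
rewrite -scalemxAl -!scalerDr; congr (_ *: _).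
rewrite [y]row_sum_delta mulmx_suml !bracket_sumr mulmx_suml.
rewrite -!big_split /=; apply: eq_bigr => j _.
by rewrite -scalemxAl !bracketZr -scalemxAl -!scalerDr wE.
Qed.

(** By linearity, [A] and [B] are the combinations of the certified matrices weighted by the
    structure constants of [w], divided by [d]. *)
Lemma basis_law_tangent d cert : 2%:R != 0 :> K -> d%:~R != 0 :> K ->
  split_check -> tangent_check d cert -> tangent_onto (@central p) g.
Proof.
move=> two_neq0 d_neq0 chk tchk w wW.
(* Requiring increasing argument indices counts each skew pair once. *)
pose T (q : 'I_n * 'I_n * 'I_n) :=
  [&& (q.1.1 < q.1.2)%N, ~~ pos_even q.1.1, ~~ pos_even q.1.2 & pos_even q.2].
pose co (q : 'I_n * 'I_n * 'I_n) :=
  bracket w (delta_mx 0 q.1.1) (delta_mx 0 q.1.2) 0 q.2.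
pose A0 : 'M[K]_n := d%:~R^-1 *: \matrix_(i, j)
  \sum_(q | T q) co q * (entry_at (cert_at cert q.1.1 q.1.2 q.2).1 i j)%:~R.
pose B0 : 'M[K]_n := d%:~R^-1 *: \matrix_(i, j)
  \sum_(q | T q) co q * (entry_at (cert_at cert q.1.1 q.1.2 q.2).2 i j)%:~R.
(* The projections enforce the block conditions whatever entries the certificate lists. *)
pose A := projE K (@central p) *m A0 *m projE K (@central p).
pose B := projZ K (@central p) *m B0 *m projZ K (@central p).
exists A, B; split.
- by rewrite /blockE /A !mulmxA projEE -!mulmxA projEE.
- by rewrite /blockZ /B !mulmxA projZZ -!mulmxA projZZ.
have gW := basis_law_split chk.
apply: eq_bracket_linear => x y; apply/rowP => t.
have E0 (i : 'I_n) : pos_even i -> delta_mx 0 i *m projE K (@central p) = 0 :> 'rV[K]_n.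
  move=> iZ; apply/rowP => j; rewrite mulmx_projE !mxE eqxx /=.
  by case: eqP => [->|]; rewrite ?mul0r //= /central -/(pos_even _) iZ mulr0.
have Z0 (v : 'rV[K]_n) : ~~ pos_even t -> (v *m projZ K (@central p)) 0 t = 0.
  by rewrite mulmx_projE /= /central -/(pos_even _) => /negPf->; rewrite mulr0.
rewrite [RHS]mxE [X in _ = X + _]mxE.
(* Both sides vanish when an argument is central or the coordinate [t] is not; the certificate
   handles the remaining triples. *)
have [xZ|xE] := boolP (pos_even x).
  have g0 v : bracket g (delta_mx 0 x) v = 0 by rewrite gW.2 (E0 x) // bracket0l mul0mx.
  by rewrite wW.2 /A !mulmxA (E0 x) // ?mul0mx !bracket0l !g0 !mul0mx !mxE !addr0.
have [yZ|yE] := boolP (pos_even y).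
  have g0 v : bracket g v (delta_mx 0 y) = 0 by rewrite gW.2 (E0 y) // bracket0r mul0mx.
  by rewrite wW.2 /A !mulmxA (E0 y) // ?mul0mx !bracket0r !g0 !mul0mx !mxE !addr0.
have [tZ|tE] := boolP (pos_even t); last first.
  have g0 v v' : bracket g v v' 0 t = 0 by rewrite gW.2 Z0.
  by rewrite wW.2 Z0 // !g0 /B !mulmxA Z0 // !addr0.
have exch (P : pred 'I_n) U (C : 'I_n -> K) :
    \sum_(m | P m) (d%:~R^-1 * \sum_(q | T q) co q * U q m) * C m =
    d%:~R^-1 * \sum_(q | T q) co q * \sum_(m | P m) U q m * C m.
  rewrite [RHS]mulr_sumr; under [RHS]eq_bigr do rewrite !mulr_sumr.
  rewrite exchange_big /=; apply: eq_bigr => m _.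
  rewrite mulr_sumr mulr_suml; apply: eq_bigr => q _.
  by rewrite !mulrA.
have AE (i m : 'I_n) : ~~ pos_even i -> A i m = if ~~ pos_even m then A0 i m else 0.
  move=> iE; rewrite /A mulmx_projE /= /central -/(pos_even _).
  case: (pos_even m) => /=; first by rewrite mulr0.
  rewrite mulr1 mul_diag_mx mxE.
  by rewrite [(\row_j _) 0 i]mxE /= /central -/(pos_even _) iE mul1r.
have BE (m : 'I_n) : B m t = if pos_even m then B0 m t else 0.
  rewrite /B mulmx_projE /= /central -/(pos_even t) tZ mulr1 mul_diag_mx mxE.
  rewrite [(\row_j _) 0 m]mxE /= /central -/(pos_even _).
  by case: (pos_even m); rewrite ?mul1r ?mul0r.
pose u q := cert_at cert (q : 'I_n * 'I_n * 'I_n).1.1 q.1.2 q.2.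
have -> : bracket g (delta_mx 0 x *m A) (delta_mx 0 y) 0 t = d%:~R^-1 *
    \sum_(q | T q) co q * \sum_(m < n | ~~ pos_even m)
      (entry_at (u q).1 x m)%:~R * (coef m y t)%:~R.
  rewrite bracket_mulmxE -exch [RHS]big_mkcond /=; apply: eq_bigr => m _.
  by rewrite AE //; case: (pos_even m); rewrite /= ?mul0r // !mxE.
have -> : bracket g (delta_mx 0 x) (delta_mx 0 y *m A) 0 t = d%:~R^-1 *
    \sum_(q | T q) co q * \sum_(m < n | ~~ pos_even m)
      (entry_at (u q).1 y m)%:~R * (coef x m t)%:~R.
  rewrite gW.1 mxE bracket_mulmxE -exch [RHS]big_mkcond -sumrN /=.
  apply: eq_bigr => m _; rewrite coefN rmorphN mulrN opprK.
  by rewrite AE //; case: (pos_even m); rewrite /= ?mul0r // !mxE.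
have -> : (bracket g (delta_mx 0 x) (delta_mx 0 y) *m B) 0 t = d%:~R^-1 *
    \sum_(q | T q) co q * \sum_(m < n | pos_even m)
      (entry_at (u q).2 m t)%:~R * (coef x y m)%:~R.
  rewrite mxE -exch [RHS]big_mkcond /=.
  apply: eq_bigr => m _; rewrite bracket_basis_law BE mulrC.
  by case: (pos_even m); rewrite /= ?mul0r // !mxE.
rewrite -!mulrDr -!big_split /=.
apply: (mulfI d_neq0); rewrite mulrA divff // mul1r.
have pick q0 : \sum_(q | T q) co q * (q == q0)%:R = if T q0 then co q0 else 0.
  rewrite big_mkcond (bigD1 q0) //= eqxx mulr1 big1 ?addr0 // => q /negPf->.
  by rewrite mulr0 if_same.
(* [w] is expanded in elementary laws: the second sum supplies the sign when [y < x], and both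
   vanish when [x = y]. *)
transitivity (d%:~R * (\sum_(q | T q) co q * (q == (x, y, t))%:R
                       - \sum_(q | T q) co q * (q == (y, x, t))%:R)).
  congr (_ * _); rewrite !pick /T /= xE yE tZ !andbT.
  case: ltngtP => [||/ord_inj ->]; rewrite /co /= ?subr0 ?sub0r //.
    by rewrite [in LHS]wW.1 [LHS]mxE.
  by rewrite (skew_diag two_neq0 _ wW.1) [LHS]mxE.
rewrite mulrBr !mulr_sumr -sumrB; apply: eq_bigr => q /and4P[lt_q q1 q2 q3].
have allE (P : pred nat) (i : 'I_n) : all P sE -> ~~ pos_even i -> P i.
  by move=> /allP allP iE; apply: allP; rewrite mem_filter mem_iota ltn_ord !andbT.
have allZ (P : pred nat) (i : 'I_n) : all P sZ -> pos_even i -> P i.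
  by move=> /allP allP iZ; apply: allP; rewrite mem_filter mem_iota ltn_ord !andbT.
have := allE _ _ (allE _ _ tchk q1) q2; rewrite lt_q => /allZ/(_ q3).
rewrite -/(u q); case: (u q) => u1 u2 chkq.
have /eqP/(congr1 (fun k : int => k%:~R : K)) := allZ _ _ (allE _ _ (allE _ _ chkq xE) yE) tZ.
move=> chk_eq; rewrite -!mulrDr [X in _ = _ * X](etrans _ chk_eq); last first.
  rewrite 2!intrD !sum_intE.
  by congr (_ + _ + _); apply: eq_bigr => m _; rewrite intrM.
have eq_nat q0 : (q == q0) = ((q.1.1 : nat, q.1.2 : nat, q.2 : nat) ==
                              (q0.1.1 : nat, q0.1.2 : nat, q0.2 : nat)).
  by case: (q) q0 => [[? ?] ?] [[? ?] ?]; rewrite !xpair_eqE.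
rewrite !eq_nat intrM intrB /=.
by case: (_ == _) (_ == _) => [] []; ring.
Qed.

End BasisLaws.

(* An item ((i, j, k), (u, v)) lists the nonzero entries of block matrices A and
   B such that g(xA, y) + g(x, yA) + g(x, y)B is d times the law whose
   only nonzero bracket, up to skew-symmetry, is [X_(i+1), X_(j+1)] = X_(k+1);
   here d = 1, 2, 5 for g5, g7, g9. *)
Definition cf (i j : nat) (c : int) : entry := (i, j, c).
Arguments cf (i j)%_N c%_Z.

Definition cert5 : certificate := ([::
  ((0, 1, 2), ([:: cf 1 1 1], [::]));
  ((0, 1, 4), ([:: cf 1 3 1], [::]));
  ((0, 3, 2), ([:: cf 3 1 1], [::]));
  ((0, 3, 4), ([:: cf 0 0 1; cf 1 1 (-1)], [::]));
  ((1, 3, 2), ([:: cf 3 0 (-1)], [::]));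
  ((1, 3, 4), ([:: cf 1 0 1], [::]))])%N.

Definition cert7 : certificate := ([::
  ((0, 1, 2), ([:: cf 0 0 1; cf 1 1 1], [:: cf 4 4 (-1); cf 6 6 (-1)]));
  ((0, 1, 4), ([:: cf 0 5 (-1); cf 3 1 (-1)], [:: cf 2 4 1]));
  ((0, 1, 6), ([:: cf 1 5 1; cf 3 0 (-1)], [:: cf 2 6 1]));
  ((0, 3, 2), ([:: cf 0 5 (-1); cf 3 1 1], [:: cf 2 4 (-1)]));
  ((0, 3, 4), ([:: cf 0 0 1; cf 3 3 1], [:: cf 2 2 (-1); cf 6 6 (-1)]));
  ((0, 3, 6), ([:: cf 1 0 (-1); cf 3 5 1], [:: cf 4 6 1]));
  ((0, 5, 2), ([:: cf 0 3 2; cf 1 5 1; cf 3 0 (-1)], [:: cf 2 6 1]));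
  ((0, 5, 4), ([:: cf 0 1 2; cf 1 0 1; cf 3 5 (-1)], [:: cf 4 6 (-1)]));
  ((0, 5, 6), ([:: cf 0 0 1; cf 5 5 1], [:: cf 2 2 (-1); cf 4 4 (-1)]));
  ((1, 3, 2), ([:: cf 1 5 (-1); cf 3 0 (-1)], [:: cf 2 6 1]));
  ((1, 3, 4), ([:: cf 1 0 1; cf 3 5 1], [:: cf 4 6 (-1)]));
  ((1, 3, 6), ([:: cf 1 1 1; cf 3 3 1], [:: cf 2 2 (-1); cf 4 4 (-1)]));
  ((1, 5, 2), ([:: cf 0 5 1; cf 1 3 2; cf 3 1 1], [:: cf 2 4 (-1)]));
  ((1, 5, 4), ([:: cf 1 1 1; cf 5 5 1], [:: cf 2 2 (-1); cf 6 6 (-1)]));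
  ((1, 5, 6), ([:: cf 1 0 1; cf 3 5 (-1)], [:: cf 4 6 1]));
  ((3, 5, 2), ([:: cf 3 3 1; cf 5 5 1], [:: cf 4 4 (-1); cf 6 6 (-1)]));
  ((3, 5, 4), ([:: cf 0 5 1; cf 3 1 1], [:: cf 2 4 1]));
  ((3, 5, 6), ([:: cf 1 5 (-1); cf 3 0 1], [:: cf 2 6 1]))])%N.

Definition cert9 : certificate := ([::
  ((0, 1, 2), ([:: cf 0 0 1; cf 1 1 2; cf 3 3 (-1); cf 7 7 (-2)], [:: cf 2 2
    2; cf 6 6 (-1); cf 8 8 1]));
  ((0, 1, 4), ([:: cf 0 7 (-3); cf 3 0 (-1); cf 5 1 (-2); cf 7 5 1], [:: cf 2
    4 2; cf 6 2 (-1); cf 8 6 (-1)]));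
  ((0, 1, 6), ([:: cf 0 3 (-2); cf 1 5 2; cf 3 1 1; cf 7 0 1], [:: cf 2 6 1;
    cf 4 2 (-1); cf 6 8 2]));
  ((0, 1, 8), ([:: cf 0 1 1; cf 1 7 2; cf 5 0 (-2); cf 7 3 1], [:: cf 2 8 3;
    cf 4 6 (-1); cf 8 4 (-2)]));
  ((0, 3, 2), ([:: cf 0 3 1; cf 1 5 (-1); cf 3 1 2; cf 7 0 2], [:: cf 2 6 2;
    cf 4 2 3; cf 6 8 (-1)]));
  ((0, 3, 4), ([:: cf 0 0 2; cf 1 1 (-1); cf 3 3 3; cf 7 7 1], [:: cf 2 2
    (-1); cf 6 6 (-2); cf 8 8 (-3)]));
  ((0, 3, 6), ([:: cf 0 1 3; cf 1 7 1; cf 5 0 (-1); cf 7 3 (-2)], [:: cf 2 8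
    (-1); cf 4 6 2; cf 8 4 (-1)]));
  ((0, 3, 8), ([:: cf 0 5 (-2); cf 1 0 (-1); cf 3 7 2; cf 5 3 1], [:: cf 4 8
    1; cf 6 4 (-1); cf 8 2 2]));
  ((0, 5, 2), ([:: cf 0 7 (-2); cf 3 0 1; cf 5 1 2; cf 7 5 (-1)], [:: cf 2 4
    (-2); cf 6 2 1; cf 8 6 1]));
  ((0, 5, 4), ([:: cf 0 5 1; cf 1 0 (-2); cf 3 7 (-1); cf 5 3 2], [:: cf 4 8
    2; cf 6 4 3; cf 8 2 (-1)]));
  ((0, 5, 6), ([:: cf 0 0 1; cf 3 3 (-2); cf 5 5 2; cf 7 7 (-1)], [:: cf 2 2
    (-1); cf 4 4 1; cf 6 6 2]));
  ((0, 5, 8), ([:: cf 0 3 3; cf 1 5 2; cf 3 1 1; cf 7 0 1], [:: cf 2 6 1; cf 4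
    2 (-1); cf 6 8 2]));
  ((0, 7, 2), ([:: cf 0 5 3; cf 1 0 (-1); cf 3 7 2; cf 5 3 1], [:: cf 4 8 1;
    cf 6 4 (-1); cf 8 2 2]));
  ((0, 7, 4), ([:: cf 0 1 2; cf 1 7 (-1); cf 5 0 1; cf 7 3 2], [:: cf 2 8 1;
    cf 4 6 (-2); cf 8 4 1]));
  ((0, 7, 6), ([:: cf 0 7 (-1); cf 3 0 (-2); cf 5 1 1; cf 7 5 2], [:: cf 2 4
    (-1); cf 6 2 (-2); cf 8 6 3]));
  ((0, 7, 8), ([:: cf 0 0 2; cf 3 3 1; cf 5 5 (-1); cf 7 7 3], [:: cf 2 2
    (-2); cf 4 4 (-3); cf 6 6 (-1)]));
  ((1, 3, 2), ([:: cf 0 7 2; cf 3 0 (-1); cf 5 1 (-2); cf 7 5 1], [:: cf 2 4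
    2; cf 6 2 4; cf 8 6 (-1)]));
  ((1, 3, 4), ([:: cf 0 5 (-1); cf 1 0 2; cf 3 7 1; cf 5 3 (-2)], [:: cf 4 8
    (-2); cf 6 4 2; cf 8 2 1]));
  ((1, 3, 6), ([:: cf 0 0 (-1); cf 3 3 2; cf 5 5 (-2); cf 7 7 1], [:: cf 2 2
    1; cf 4 4 (-1); cf 6 6 3]));
  ((1, 3, 8), ([:: cf 0 3 (-3); cf 1 5 (-2); cf 3 1 (-1); cf 7 0 (-1)], [::
    cf 2 6 (-1); cf 4 2 1; cf 6 8 3]));
  ((1, 5, 2), ([:: cf 0 1 1; cf 1 7 (-3); cf 5 0 (-2); cf 7 3 1], [:: cf 2 8
    3; cf 4 6 (-1); cf 8 4 (-2)]));
  ((1, 5, 4), ([:: cf 0 3 (-3); cf 1 5 (-2); cf 3 1 (-1); cf 5 7 5; cf 7 0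
    (-1)], [:: cf 2 6 (-1); cf 4 2 1; cf 6 8 (-2)]));
  ((1, 5, 6), ([:: cf 0 5 (-1); cf 1 0 2; cf 3 7 1; cf 5 3 3], [:: cf 4 8
    (-2); cf 6 4 (-3); cf 8 2 1]));
  ((1, 5, 8), ([:: cf 0 7 3; cf 1 3 5; cf 3 0 1; cf 5 1 2; cf 7 5 (-1)], [::
    cf 2 4 (-2); cf 6 2 1; cf 8 6 1]));
  ((1, 7, 2), ([:: cf 0 3 (-1); cf 1 5 1; cf 3 1 (-2); cf 7 0 (-2)], [:: cf 2
    6 (-2); cf 4 2 2; cf 6 8 1]));
  ((1, 7, 4), ([:: cf 0 0 (-1); cf 1 1 2; cf 3 3 (-2); cf 5 5 1], [:: cf 2 2
    (-1); cf 4 4 3; cf 8 8 1]));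
  ((1, 7, 6), ([:: cf 0 1 (-3); cf 1 7 (-1); cf 5 0 1; cf 7 3 2], [:: cf 2 8
    1; cf 4 6 3; cf 8 4 1]));
  ((1, 7, 8), ([:: cf 0 5 2; cf 1 0 1; cf 3 7 (-2); cf 5 3 (-1)], [:: cf 4 8
    4; cf 6 4 1; cf 8 2 (-2)]));
  ((3, 5, 2), ([:: cf 0 5 (-3); cf 1 0 1; cf 3 7 (-2); cf 5 3 (-1)], [:: cf 4
    8 (-1); cf 6 4 1; cf 8 2 3]));
  ((3, 5, 4), ([:: cf 0 1 (-2); cf 1 7 1; cf 5 0 (-1); cf 7 3 (-2)], [:: cf 2
    8 (-1); cf 4 6 2; cf 8 4 4]));
  ((3, 5, 6), ([:: cf 0 7 1; cf 3 0 2; cf 5 1 (-1); cf 7 5 (-2)], [:: cf 2 4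
    1; cf 6 2 2; cf 8 6 2]));
  ((3, 5, 8), ([:: cf 0 0 (-1); cf 1 1 1; cf 5 5 2; cf 7 7 (-2)], [:: cf 4 4
    1; cf 6 6 (-1); cf 8 8 3]));
  ((3, 7, 2), ([:: cf 0 1 (-3); cf 1 7 (-1); cf 3 5 5; cf 5 0 1; cf 7 3 2],
    [:: cf 2 8 1; cf 4 6 (-2); cf 8 4 1]));
  ((3, 7, 4), ([:: cf 0 3 (-1); cf 1 5 1; cf 3 1 3; cf 7 0 (-2)], [:: cf 2 6
    (-2); cf 4 2 (-3); cf 6 8 1]));
  ((3, 7, 6), ([:: cf 0 5 3; cf 1 0 (-1); cf 3 7 2; cf 5 3 1; cf 7 1 (-5)],
    [:: cf 4 8 1; cf 6 4 (-1); cf 8 2 2]));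
  ((3, 7, 8), ([:: cf 0 7 1; cf 3 0 2; cf 5 1 (-1); cf 7 5 3], [:: cf 2 4 1;
    cf 6 2 2; cf 8 6 (-3)]));
  ((5, 7, 2), ([:: cf 0 0 (-1); cf 1 1 (-2); cf 3 3 1; cf 7 7 2], [:: cf 2 2
    3; cf 6 6 1; cf 8 8 (-1)]));
  ((5, 7, 4), ([:: cf 0 7 3; cf 3 0 1; cf 5 1 2; cf 7 5 (-1)], [:: cf 2 4 3;
    cf 6 2 1; cf 8 6 1]));
  ((5, 7, 6), ([:: cf 0 3 2; cf 1 5 (-2); cf 3 1 (-1); cf 7 0 (-1)], [:: cf 2
    6 4; cf 4 2 1; cf 6 8 (-2)]));
  ((5, 7, 8), ([:: cf 0 1 (-1); cf 1 7 (-2); cf 5 0 2; cf 7 3 (-1)], [:: cf 2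
    8 2; cf 4 6 1; cf 8 4 2]))])%N.

Lemma basis_law_rigid (K : closedFieldType) (p d : nat) b cert :
    [pchar K] =i pred0 -> (0 < p)%N -> (0 < d)%N ->
    split_check b -> adapted_check p b -> tangent_check p b d cert ->
  rigid (basis_law K p.*2.+1 b) /\
  forall mu : law K p.*2.+1,
    two_nilp mu -> char_sequence mu (rcons (nseq p 2%N) 1%N) ->
    exists2 nu, contraction (basis_law K p.*2.+1 b) nu & law_orbit nu mu.
Proof.
move=> /pcharf0P charK0 p_gt0 d_gt0 chkS chkA chkT.
have two_neq0 : 2%:R != 0 :> K by rewrite charK0.
have d_neq0 : (Posz d)%:~R != 0 :> K by rewrite -pmulrn charK0 -lt0n.
have g_split := basis_law_split p K chkS.
have g_onto := basis_law_tangent two_neq0 d_neq0 chkS chkT.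
split.
  exact: (split_law_rigid two_neq0 p_gt0 g_split g_onto (basis_law_adapted K chkA)).
by move=> mu; apply: (familyF_contraction two_neq0 p_gt0 g_split g_onto).
Qed.

Theorem proposition8 (K : closedFieldType) (charK0 : [pchar K] =i pred0) :
  [/\ rigid (g5 K),
      rigid (g7 K) /\
        (forall mu : law K 7, familyF (p := 3) mu ->
           exists2 nu : law K 7, contraction (g7 K) nu & law_orbit nu mu)
    & rigid (g9 K) /\
        (forall mu : law K 9, familyF (p := 4) mu ->
           exists2 nu : law K 9, contraction (g9 K) nu & law_orbit nu mu)].
Proof.
(* The numerals are [p] and the denominator [d]; the last three [isT] are the integer checks,
   settled by computation. *)
have [rigid5 _] := @basis_law_rigid K 2 1 [:: (1, 2, 3); (1, 4, 5)]%N cert5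
  charK0 isT isT isT isT isT.
have [rigid7 contr7] := @basis_law_rigid K 3 2
  [:: (1, 2, 3); (1, 4, 5); (1, 6, 7); (2, 4, 7); (2, 6, 5); (4, 6, 3)]%N cert7
  charK0 isT isT isT isT isT.
have [rigid9 contr9] := @basis_law_rigid K 4 5
  [:: (1, 2, 3); (1, 4, 5); (1, 6, 7); (1, 8, 9);
      (2, 4, 7); (2, 8, 5); (4, 6, 9); (6, 8, 3)]%N cert9
  charK0 isT isT isT isT isT.
by split=> //; split=> // mu []; [apply: contr7 | apply: contr9].
Qed.
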